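(* (Schwarz lemma for biharmonic mappings) Let $H:\mathbb{D}\to\mathbb{D}$ be harmonic, $H=w_1+\overline{w_2}$ with $w_1,w_2$ analytic in $\mathbb{D}=\{|z|<1\}$. Suppose $u:\mathbb{D}\to\mathbb{D}$ is the biharmonic function $$u(z)=H(z)+\frac{1}{2}(1-|z|^{2})\big(zw_1'(z)+\overline{zw_2'(z)}\big)$$ and $u(0)=0$. Then for all $z\in\mathbb{D}$, $$|u(z)|\le \frac{4}{\pi}\arctan(|z|)+|z|,$$ and $$\Lambda_u(0)=|u_z(0)|+|u_{\overline z}(0)|\le \frac{6}{\pi}.$$ *)

(* Defs.v *)
From Stdlib Require Import Reals.
From Coquelicot Require Import Coquelicot.
Open Scope R_scope.
Open Scope C_scope.

Definition in_disc (z : Complex.C) : Prop := (Cmod z < 1)%R.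

Definition analytic_on_disc_with (f df : Complex.C -> Complex.C) : Prop :=
  forall z, in_disc z -> @is_derive C_AbsRing C_NormedModule f z (df z).

Definition harmH (w1 w2 : Complex.C -> Complex.C) (z : Complex.C) : Complex.C :=
  w1 z + Cconj (w2 z).

Definition biharm_u (w1 w2 dw1 dw2 : Complex.C -> Complex.C) (z : Complex.C)
  : Complex.C :=
  harmH w1 w2 z
  + RtoC ((1 - (Cmod z) ^ 2) / 2) * (z * dw1 z + Cconj (z * dw2 z)).

Definition dx (f : Complex.C -> Complex.C) (z0 : Complex.C) : Complex.C :=
  (Derive (fun t => Re (f (z0 + RtoC t))) 0,
   Derive (fun t => Im (f (z0 + RtoC t))) 0).
Definition dy (f : Complex.C -> Complex.C) (z0 : Complex.C) : Complex.C :=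
  (Derive (fun t => Re (f (z0 + Ci * RtoC t))) 0,
   Derive (fun t => Im (f (z0 + Ci * RtoC t))) 0).

Definition dz (f : Complex.C -> Complex.C) (z0 : Complex.C) : Complex.C :=
  RtoC (1/2) * (dx f z0 - Ci * dy f z0).
Definition dzbar (f : Complex.C -> Complex.C) (z0 : Complex.C) : Complex.C :=
  RtoC (1/2) * (dx f z0 + Ci * dy f z0).

Definition Lambda (f : Complex.C -> Complex.C) (z0 : Complex.C) : R :=
  (Cmod (dz f z0) + Cmod (dzbar f z0))%R.

(* Main.v *)
Require Import Defs.
From Stdlib Require Import Reals Lra Classical IndefiniteDescription.
From Coquelicot Require Import Coquelicot.
Open Scope R_scope.

(** Since [u 0 = H 0 = 0], it suffices to bound the harmonic map [H] and its
    first derivatives. For unimodular [l], [Re (l H)] is the real part of the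
    analytic function [f = l w1 + (conj l) w2], whose values lie in the strip
    [|Re| < 1]. Goursat's argument on polar rectangles shows that the circular
    means of [Re g] do not depend on the radius for [g] analytic on the punctured
    disc; with [g z = (f z - f 0) (z / rho^2 + 1 / z - 2 cos alpha / rho)] this
    gives [2 PI Re (f' 0) = (2 / rho) \int (Re f - Re f(0)) (cos t - cos alpha) dt],
    and [alpha = PI (1 + Re (f 0)) / 2] yields
    [|f' 0| <= (4 / PI) cos (PI Re (f 0) / 2)]. Precomposing with disc automorphisms
    turns this into a Schwarz-Pick inequality at every point, and integrating it
    along radii gives [|H z| <= (4 / PI) atan |z|]. It also gives
    [(|w1'| + |w2'|) (1 - |z|^2) <= 4 / PI], which controls the second summand of
    [u], and [Lambda u 0 = (3 / 2) (|w1' 0| + |w2' 0|) <= 6 / PI]. That the partial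
    derivatives of [u] exist at [0] uses the continuity of [w1'] and [w2'] there. *)

(** * Goursat's theorem for closed forms on rectangles *)

(** Comparison with the affine functions [k + m s - e] and [k + m s + e], which have explicit
    primitives. It serves for the sides of small rectangles and, with [m = 0], for means close to a
    constant. *)
Lemma RInt_near_affine (f : R -> R) (a b k m e : R) :
  a <= b -> ex_RInt f a b ->
  (forall s, a <= s <= b -> Rabs (f s - (k + m * s)) <= e) ->
  Rabs (RInt f a b - (k * (b - a) + m * (b ^ 2 - a ^ 2) / 2)) <= e * (b - a).
Proof.
  intros Hab Hf He.
  assert (Haff : forall c, is_RInt (fun s => k + m * s + c) a b
      (k * (b - a) + m * (b ^ 2 - a ^ 2) / 2 + c * (b - a))).
  { intros c.
    evar (v : R). replace (_ + _) with v; unfold v.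
    apply (is_RInt_derive (fun s => k * s + m * s ^ 2 / 2 + c * s)).
    - intros s _. auto_derive; [exact I|field].
    - intros s _. apply continuity_pt_filterlim. reg.
    - unfold minus, plus, opp; simpl. field. }
  assert (Hf' : is_RInt f a b (RInt f a b)) by (apply (RInt_correct (V := R_CompleteNormedModule)), Hf).
  assert (H1 := is_RInt_le _ _ _ _ _ _ Hab Hf' (Haff e)).
  assert (H2 := is_RInt_le _ _ _ _ _ _ Hab (Haff (- e)) Hf').
  apply Rabs_le. split.
  - assert (H : k * (b - a) + m * (b ^ 2 - a ^ 2) / 2 + - e * (b - a) <= RInt f a b); [|lra].
    apply H2. intros s Hs. specialize (He s ltac:(lra)). apply Rabs_le_between in He. lra.
  - assert (H : RInt f a b <= k * (b - a) + m * (b ^ 2 - a ^ 2) / 2 + e * (b - a)); [|lra].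
    apply H1. intros s Hs. specialize (He s ltac:(lra)). apply Rabs_le_between in He. lra.
Qed.

(** Integral of [P dx + Q dy] counterclockwise around the boundary of [[a, b] x [c, d]]. *)
Definition rect_circulation (P Q : R -> R -> R) (a b c d : R) : R :=
  RInt (fun s => P s c) a b + RInt (fun t => Q b t) c d
  - RInt (fun s => P s d) a b - RInt (fun t => Q a t) c d.

(** Closedness is the shared [p2], at once the [y]-derivative of [P] and the [x]-derivative of [Q].
    Differentiability is only pointwise, hence subdivision below instead of Green's formula. *)
Definition closed_form_on (P Q : R -> R -> R) (a b c d : R) : Prop :=
  forall x y, a <= x <= b -> c <= y <= d -> exists p1 p2 q2,
    differentiable_pt_lim P x y p1 p2 /\ differentiable_pt_lim Q x y p2 q2.

Lemma differentiable_pt_lim_continuous (f : R -> R -> R) (x y lx ly : R) :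
  differentiable_pt_lim f x y lx ly ->
  continuous (fun s => f s y) x /\ continuous (fun t => f x t) y.
Proof.
  intros H. split; apply (@ex_derive_continuous R_AbsRing R_NormedModule).
  - exists (lx * 1 + ly * 0). apply is_derive_Reals.
    apply (derivable_pt_lim_comp_2d f (fun s => s) (fun _ => y)); trivial.
    + apply derivable_pt_lim_id.
    + apply derivable_pt_lim_const.
  - exists (lx * 0 + ly * 1). apply is_derive_Reals.
    apply (derivable_pt_lim_comp_2d f (fun _ => x) (fun s => s)); trivial.
    + apply derivable_pt_lim_const.
    + apply derivable_pt_lim_id.
Qed.

Lemma closed_form_on_sub (P Q : R -> R -> R) (a b c d a' b' c' d' : R) :
  closed_form_on P Q a b c d ->
  a <= a' -> b' <= b -> c <= c' -> d' <= d ->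
  closed_form_on P Q a' b' c' d'.
Proof.
  intros H Ha Hb Hc Hd x y Hx Hy. apply H; lra.
Qed.

Lemma closed_form_on_ex_RInt (P Q : R -> R -> R) (a b c d : R) :
  closed_form_on P Q a b c d ->
  (forall y a' b', c <= y <= d -> a <= a' -> a' <= b' -> b' <= b -> ex_RInt (fun s => P s y) a' b') /\
  (forall x c' d', a <= x <= b -> c <= c' -> c' <= d' -> d' <= d -> ex_RInt (fun t => Q x t) c' d').
Proof.
  intros H. split.
  - intros y a' b' Hy Ha Hab Hb. apply (ex_RInt_continuous (V := R_CompleteNormedModule)).
    intros s Hs. rewrite Rmin_left, Rmax_right in Hs by lra.
    destruct (H s y) as (p1 & p2 & q2 & HP & HQ); [lra..|].
    apply (differentiable_pt_lim_continuous _ _ _ _ _ HP).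
  - intros x c' d' Hx Hc Hcd Hd. apply (ex_RInt_continuous (V := R_CompleteNormedModule)).
    intros t Ht. rewrite Rmin_left, Rmax_right in Ht by lra.
    destruct (H x t) as (p1 & p2 & q2 & HP & HQ); [lra..|].
    apply (differentiable_pt_lim_continuous _ _ _ _ _ HQ).
Qed.

(** Each interior side is traversed twice in opposite directions and cancels. *)
Lemma rect_circulation_quarters (P Q : R -> R -> R) (a b c d : R) :
  a <= b -> c <= d -> closed_form_on P Q a b c d ->
  let m := (a + b) / 2 in let n := (c + d) / 2 in
  rect_circulation P Q a b c d =
  rect_circulation P Q a m c n + rect_circulation P Q m b c n
  + rect_circulation P Q a m n d + rect_circulation P Q m b n d.
Proof.
  intros Hab Hcd H m n.
  assert (Hm : a <= m <= b) by (unfold m; lra).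
  assert (Hn : c <= n <= d) by (unfold n; lra).
  destruct (closed_form_on_ex_RInt _ _ _ _ _ _ H) as [HP HQ].
  assert (HxP : forall y, c <= y <= d ->
     RInt (fun s => P s y) a b = RInt (fun s => P s y) a m + RInt (fun s => P s y) m b).
  { intros y Hy. symmetry. apply (RInt_Chasles (V := R_CompleteNormedModule)); apply HP; lra. }
  assert (HyQ : forall x, a <= x <= b ->
     RInt (fun t => Q x t) c d = RInt (fun t => Q x t) c n + RInt (fun t => Q x t) n d).
  { intros x Hx. symmetry. apply (RInt_Chasles (V := R_CompleteNormedModule)); apply HQ; lra. }
  unfold rect_circulation.
  rewrite (HxP c), (HxP d), (HyQ a), (HyQ b) by lra. ring.
Qed.

(** By the triangle inequality, one of the four quarters carries at least a quarter of the
    circulation. *)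
Lemma rect_circulation_quarter_large (P Q : R -> R -> R) (a b c d : R) :
  a <= b -> c <= d -> closed_form_on P Q a b c d ->
  exists a' b' c' d', a <= a' /\ a' <= b' /\ b' <= b /\ c <= c' /\ c' <= d' /\ d' <= d /\
    b' - a' = (b - a) / 2 /\ d' - c' = (d - c) / 2 /\
    Rabs (rect_circulation P Q a b c d) <= 4 * Rabs (rect_circulation P Q a' b' c' d').
Proof.
  intros Hab Hcd H.
  set (m := (a + b) / 2). set (n := (c + d) / 2).
  assert (Hm : m - a = (b - a) / 2 /\ b - m = (b - a) / 2) by (unfold m; lra).
  assert (Hn : n - c = (d - c) / 2 /\ d - n = (d - c) / 2) by (unfold n; lra).
  pose proof (rect_circulation_quarters P Q a b c d Hab Hcd H) as E.
  cbv zeta in E. fold m n in E.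
  set (A := rect_circulation P Q a b c d) in *.
  set (A1 := rect_circulation P Q a m c n) in *.
  set (A2 := rect_circulation P Q m b c n) in *.
  set (A3 := rect_circulation P Q a m n d) in *.
  set (A4 := rect_circulation P Q m b n d) in *.
  assert (T : Rabs A <= Rabs A1 + Rabs A2 + Rabs A3 + Rabs A4).
  { rewrite E. eapply Rle_trans; [apply Rabs_triang|].
    apply Rplus_le_compat_r. eapply Rle_trans; [apply Rabs_triang|].
    apply Rplus_le_compat_r. apply Rabs_triang. }
  destruct (Rle_dec (Rabs A) (4 * Rabs A1)); [exists a, m, c, n; repeat split; trivial; lra|].
  destruct (Rle_dec (Rabs A) (4 * Rabs A2)); [exists m, b, c, n; repeat split; trivial; lra|].
  destruct (Rle_dec (Rabs A) (4 * Rabs A3)); [exists a, m, n, d; repeat split; trivial; lra|].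
  exists m, b, n, d; repeat split; trivial; fold A4; lra.
Qed.

(** The affine parts have circulation exactly zero, since both contain the same [p2]. What remains
    is the error [e] times the perimeter. *)
Lemma rect_circulation_near_affine (P Q : R -> R -> R) (a b c d x y p0 p1 p2 q0 q2 e : R) :
  a <= b -> c <= d -> closed_form_on P Q a b c d ->
  (forall u v, a <= u <= b -> c <= v <= d ->
     Rabs (P u v - p0 - (p1 * (u - x) + p2 * (v - y))) <= e) ->
  (forall u v, a <= u <= b -> c <= v <= d ->
     Rabs (Q u v - q0 - (p2 * (u - x) + q2 * (v - y))) <= e) ->
  Rabs (rect_circulation P Q a b c d) <= 2 * e * ((b - a) + (d - c)).
Proof.
  intros Hab Hcd H HP HQ.
  destruct (closed_form_on_ex_RInt _ _ _ _ _ _ H) as [IP IQ].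
  assert (EP : forall v, c <= v <= d -> Rabs (RInt (fun s => P s v) a b -
     ((p0 - p1 * x + p2 * (v - y)) * (b - a) + p1 * (b ^ 2 - a ^ 2) / 2)) <= e * (b - a)).
  { intros v Hv. apply RInt_near_affine; [lra|apply IP; lra|].
    intros s Hs. eapply Rle_trans; [|apply (HP s v); lra]. right; f_equal; ring. }
  assert (EQ : forall u, a <= u <= b -> Rabs (RInt (fun t => Q u t) c d -
     ((q0 - q2 * y + p2 * (u - x)) * (d - c) + q2 * (d ^ 2 - c ^ 2) / 2)) <= e * (d - c)).
  { intros u Hu. apply RInt_near_affine; [lra|apply IQ; lra|].
    intros s Hs. eapply Rle_trans; [|apply (HQ u s); lra]. right; f_equal; ring. }
  unfold rect_circulation.
  assert (E1 := EP c ltac:(lra)). assert (E2 := EP d ltac:(lra)).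
  assert (E3 := EQ a ltac:(lra)). assert (E4 := EQ b ltac:(lra)).
  apply Rabs_le_between in E1, E2, E3, E4. apply Rabs_le. lra.
Qed.

Lemma nested_intervals_point (a b : nat -> R) :
  (forall n, a n <= a (S n)) -> (forall n, b (S n) <= b n) -> (forall n, a n <= b n) ->
  exists x, forall n, a n <= x <= b n.
Proof.
  intros Ha Hb Hab.
  assert (Ma : forall n k, a n <= a (n + k)%nat).
  { intros n k; induction k; [rewrite Nat.add_0_r; lra|].
    rewrite Nat.add_succ_r. specialize (Ha (n + k)%nat). lra. }
  assert (Mb : forall n k, b (n + k)%nat <= b n).
  { intros n k; induction k; [rewrite Nat.add_0_r; lra|].
    rewrite Nat.add_succ_r. specialize (Hb (n + k)%nat). lra. }
  assert (L : forall n k, a n <= b k).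
  { intros n k. specialize (Ma n k). specialize (Mb k n). rewrite Nat.add_comm in Mb.
    specialize (Hab (n + k)%nat). lra. }
  destruct (completeness (fun r => exists n, r = a n)) as [x [Ux Lx]].
  - exists (b 0%nat). intros r [n ->]. apply L.
  - exists (a 0%nat). exists 0%nat. reflexivity.
  - exists x. intros n. split.
    + apply Ux. now exists n.
    + apply Lx. intros r [k ->]. apply L.
Qed.

(** Repeated quartering gives rectangles shrinking to a point [(x, y)] whose circulation is at least
    [4^-n] times the initial one. Differentiability at [(x, y)] bounds it by an arbitrarily small
    multiple of [4^-n]. *)
Theorem rect_circulation_zero (P Q : R -> R -> R) (a b c d : R) :
  a <= b -> c <= d -> closed_form_on P Q a b c d -> rect_circulation P Q a b c d = 0.
Proof.
  intros Hab Hcd H.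
  set (ok := fun s : R * R * R * R => let '(a', b', c', d') := s in
    a <= a' /\ a' <= b' /\ b' <= b /\ c <= c' /\ c' <= d' /\ d' <= d).
  set (circ := fun s : R * R * R * R => let '(a', b', c', d') := s in
    rect_circulation P Q a' b' c' d').
  set (refines := fun s s' : R * R * R * R => let '(a', b', c', d') := s in
    let '(a'', b'', c'', d'') := s' in
    a' <= a'' /\ b'' <= b' /\ c' <= c'' /\ d'' <= d' /\
    b'' - a'' = (b' - a') / 2 /\ d'' - c'' = (d' - c') / 2 /\
    Rabs (circ s) <= 4 * Rabs (circ s')).
  (* [ok s] sits under the existential because choice needs a total relation; a degenerate [s] is
     sent to itself. *)
  assert (Hstep : forall s, exists s', ok s -> ok s' /\ refines s s').
  { intros [[[a1 b1] c1] d1].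
    destruct (classic (ok (a1, b1, c1, d1))) as [Hok|Hno];
      [|exists (a1, b1, c1, d1); tauto].
    destruct Hok as (k1 & k2 & k3 & k4 & k5 & k6).
    destruct (rect_circulation_quarter_large P Q a1 b1 c1 d1)
      as (a2 & b2 & c2 & d2 & K); [trivial..| |].
    { apply (closed_form_on_sub _ _ _ _ _ _ _ _ _ _ H); lra. }
    exists (a2, b2, c2, d2). intros _.
    destruct K as (l1 & l2 & l3 & l4 & l5 & l6 & l7 & l8 & l9). simpl.
    repeat split; trivial; lra. }
  destruct (functional_choice _ Hstep) as [step Hs].
  set (s := fix s (n : nat) := match n with O => (a, b, c, d) | S k => step (s k) end).
  assert (Hok : forall n, ok (s n)).
  { induction n; [simpl; repeat split; lra|]. simpl. apply Hs, IHn. }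
  assert (Href : forall n, refines (s n) (s (S n))).
  { intros n. simpl. apply Hs, Hok. }
  set (A := fun n => fst (fst (fst (s n)))). set (B := fun n => snd (fst (fst (s n)))).
  set (X := fun n => snd (fst (s n))). set (Y := fun n => snd (s n)).
  assert (Es : forall n, s n = (A n, B n, X n, Y n)).
  { intros n. unfold A, B, X, Y. destruct (s n) as [[[? ?] ?] ?]. reflexivity. }
  destruct (nested_intervals_point A B) as [x Hx].
  1,2,3: intros n; pose proof (Hok n) as K; pose proof (Href n) as K'; rewrite Es in K;
    rewrite (Es n), (Es (S n)) in K'; simpl in K, K'; lra.
  destruct (nested_intervals_point X Y) as [y Hy].
  1,2,3: intros n; pose proof (Hok n) as K; pose proof (Href n) as K'; rewrite Es in K;
    rewrite (Es n), (Es (S n)) in K'; simpl in K, K'; lra.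
  set (q := fun n => (/ 2) ^ n).
  assert (Hsize : forall n, B n - A n = (b - a) * q n /\ Y n - X n = (d - c) * q n /\
     Rabs (circ (s 0%nat)) * q n ^ 2 <= Rabs (circ (s n))).
  { induction n as [|n IH].
    - unfold q; simpl. split; [|split]; try (unfold A, B, X, Y; simpl; lra).
    - pose proof (Href n) as K'. rewrite (Es n), (Es (S n)) in K'. unfold refines in K'.
      rewrite <- !Es in K'.
      assert (Eq : q (S n) = q n / 2) by (unfold q; simpl; lra).
      rewrite Eq. destruct IH as (I1 & I2 & I3).
      destruct K' as (_ & _ & _ & _ & K5 & K6 & K7).
      repeat split; lra. }
  assert (Hq : forall n, 0 < q n) by (intros n; apply pow_lt; lra).
  destruct (H x y) as (p1 & p2 & q2 & HP & HQ).
  { specialize (Hx 0%nat). unfold A, B in Hx; simpl in Hx; lra. }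
  { specialize (Hy 0%nat). unfold X, Y in Hy; simpl in Hy; lra. }
  set (L := (b - a) + (d - c)).
  assert (HL : 0 <= L) by (unfold L; lra).
  (* At stage [n] the affine error is at most [eps * (L * q n)] and the perimeter is [2 * L * q n];
     the factor [q n ^ 2] then cancels. *)
  assert (Hall : forall eps, 0 < eps -> Rabs (circ (s 0%nat)) <= 2 * L ^ 2 * eps).
  { intros eps He.
    destruct (HP (mkposreal eps He)) as [d1 Hd1].
    destruct (HQ (mkposreal eps He)) as [d2 Hd2]. simpl in Hd1, Hd2.
    assert (Hd : 0 < Rmin d1 d2 / (L + 1)).
    { apply Rdiv_lt_0_compat; [apply Rmin_pos; apply cond_pos|lra]. }
    destruct (pow_lt_1_zero (/ 2) ltac:(rewrite Rabs_pos_eq; lra) _ Hd) as [n Hn].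
    specialize (Hn n (le_n n)). fold (q n) in Hn.
    rewrite (Rabs_pos_eq (q n)) in Hn by (specialize (Hq n); lra).
    apply (Rmult_lt_compat_r (L + 1)) in Hn; [|lra].
    unfold Rdiv in Hn. rewrite Rmult_assoc, Rinv_l, Rmult_1_r in Hn by lra.
    destruct (Hsize n) as (S1 & S2 & S3). specialize (Hq n).
    assert (Hmax : forall u v, A n <= u <= B n -> X n <= v <= Y n ->
      Rabs (u - x) <= L * q n /\ Rabs (v - y) <= L * q n).
    { intros u v Hu Hv. specialize (Hx n). specialize (Hy n).
      assert (0 <= (b - a) * q n) by nra. assert (0 <= (d - c) * q n) by nra.
      split; apply Rabs_le; unfold L; nra. }
    assert (Hmin1 := Rmin_l d1 d2). assert (Hmin2 := Rmin_r d1 d2).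
    pose proof (Hok n) as K. rewrite Es in K. simpl in K.
    assert (Bd : Rabs (circ (s n)) <= 2 * (eps * (L * q n)) * ((B n - A n) + (Y n - X n))).
    { rewrite Es. apply rect_circulation_near_affine with x y (P x y) p1 p2 (Q x y) q2; try tauto.
      - apply (closed_form_on_sub _ _ _ _ _ _ _ _ _ _ H); lra.
      - intros u v Hu Hv. destruct (Hmax u v Hu Hv).
        eapply Rle_trans; [apply Hd1; lra|].
        apply Rmult_le_compat_l; [lra|]. apply Rmax_lub; lra.
      - intros u v Hu Hv. destruct (Hmax u v Hu Hv).
        eapply Rle_trans; [apply Hd2; lra|].
        apply Rmult_le_compat_l; [lra|]. apply Rmax_lub; lra. }
    rewrite S1, S2 in Bd.
    apply Rmult_le_reg_r with (q n ^ 2); [apply pow_lt; lra|].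
    eapply Rle_trans; [exact S3|]. eapply Rle_trans; [exact Bd|]. right. unfold L. ring. }
  change (circ (s 0%nat) = 0).
  destruct (Req_dec (circ (s 0%nat)) 0) as [E|N]; [exact E|exfalso].
  apply Rabs_pos_lt in N.
  set (r := Rabs (circ (s 0%nat))) in *.
  (* Taken as [eps], this yields [r <= r / 2]; the [+ 1] covers [L = 0]. *)
  assert (Hr : 0 < r / (2 * L ^ 2 + 1) / 2).
  { repeat apply Rdiv_lt_0_compat; try lra. nra. }
  specialize (Hall _ Hr).
  assert (E : 2 * L ^ 2 * (r / (2 * L ^ 2 + 1) / 2) <= r / 2).
  { apply Rmult_le_reg_r with (2 * L ^ 2 + 1); [nra|]. field_simplify; nra. }
  lra.
Qed.

(** * Complex derivatives *)

(* Coquelicot's product and chain rules take values in [C] as a module over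
   itself, whose uniform structure is not that of [C_NormedModule]. *)
Definition cderiv (f : C -> C) (z l : C) : Prop :=
  @is_derive C_AbsRing (AbsRing_NormedModule C_AbsRing) f z l.

Lemma is_derive_cderiv f z l : @is_derive C_AbsRing C_NormedModule f z l -> cderiv f z l.
Proof.
  intros [_ H]. split; [|exact H].
  apply (@is_linear_scal_l C_AbsRing (AbsRing_NormedModule C_AbsRing)).
Qed.

Lemma cderiv_mult f g z l m : cderiv f z l -> cderiv g z m ->
  cderiv (fun z => (f z * g z)%C) z (l * g z + f z * m)%C.
Proof. intros H H'. exact (@is_derive_mult C_AbsRing f g z l m H H' Cmult_comm). Qed.

Lemma cderiv_plus f g z l m : cderiv f z l -> cderiv g z m ->
  cderiv (fun z => (f z + g z)%C) z (l + m)%C.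
Proof.
  intros H H'.
  exact (@is_derive_plus C_AbsRing (AbsRing_NormedModule C_AbsRing) f g z l m H H').
Qed.

Lemma cderiv_comp f g z l m : cderiv f (g z) l -> cderiv g z m ->
  cderiv (fun z => f (g z)) z (m * l)%C.
Proof.
  intros H H'.
  exact (@is_derive_comp C_AbsRing (AbsRing_NormedModule C_AbsRing) f g z l m H H').
Qed.

Lemma cderiv_const c z : cderiv (fun _ => c) z 0%C.
Proof. exact (@is_derive_const C_AbsRing (AbsRing_NormedModule C_AbsRing) c z). Qed.

Lemma cderiv_id z : cderiv (fun z => z) z 1%C.
Proof. exact (@is_derive_id C_AbsRing z). Qed.

Lemma cderiv_eq f z l l' : cderiv f z l -> l = l' -> cderiv f z l'.
Proof. intros H <-; exact H. Qed.

Lemma cderiv_cmul f c z l : cderiv f z l -> cderiv (fun z => (c * f z)%C) z (c * l)%C.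
Proof.
  intros H. eapply cderiv_eq; [apply (cderiv_mult (fun _ => c) f), H; apply cderiv_const|].
  ring.
Qed.

Lemma cderivE f z l : cderiv f z l <->
  (forall eps, 0 < eps -> exists d, 0 < d /\ forall w, Cmod (w - z) < d ->
     Cmod (f w - f z - (w - z) * l) <= eps * Cmod (w - z)).
Proof.
  split.
  - intros [_ H] eps He. destruct (H z (fun P HP => HP) (mkposreal eps He)) as [d Hd].
    exists d; split; [apply cond_pos|]. intros w Hw. apply (Hd w Hw).
  - intros H. split; [apply (@is_linear_scal_l C_AbsRing (AbsRing_NormedModule C_AbsRing))|].
    intros y Hy.
    assert (Hyz : z = y).
    { exact (@is_filter_lim_locally_unique C_AbsRing (AbsRing_NormedModule C_AbsRing) z y Hy). }
    subst y. intros eps. destruct (H eps (cond_pos eps)) as (d & d0 & Hd).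
    exists (mkposreal d d0). exact Hd.
Qed.

(** The remainder of the first-order expansion is exactly [(w - z)^2 / (z^2 w)]. *)
Lemma cderiv_inv (z : C) : z <> 0%C -> cderiv Cinv z (- / (z * z))%C.
Proof.
  intros Hz. assert (Pz : 0 < Cmod z) by (apply Cmod_gt_0, Hz).
  apply cderivE. intros eps He.
  (* The first bound keeps [|w| > |z| / 2]; given that, the second makes the remainder at most
     [eps |w - z|]. *)
  exists (Rmin (Cmod z / 2) (eps * Cmod z ^ 3 / 2)). split.
  { apply Rmin_pos; [lra|]. apply Rdiv_lt_0_compat; [|lra].
    apply Rmult_lt_0_compat; [lra|apply pow_lt, Pz]. }
  intros w Hw.
  assert (H1 := Rlt_le_trans _ _ _ Hw (Rmin_l _ _)).
  assert (H2 := Rlt_le_trans _ _ _ Hw (Rmin_r _ _)).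
  assert (Hw2 : Cmod z / 2 < Cmod w).
  { pose proof (Cmod_triangle w (- (w - z))) as T. rewrite Cmod_opp in T.
    replace (w + - (w - z))%C with z in T by ring. lra. }
  assert (Nw : w <> 0%C) by (apply Cmod_gt_0; lra).
  replace (/ w - / z - (w - z) * (- / (z * z)))%C
    with ((w - z) * (w - z) / (z * z * w))%C by (field; tauto).
  rewrite Cmod_div by (repeat apply Cmult_neq_0; trivial). rewrite !Cmod_mult.
  set (h := Cmod (w - z)) in *. assert (0 <= h) by apply Cmod_ge_0.
  assert (P3 : 0 < Cmod z * Cmod z * Cmod w) by (repeat apply Rmult_lt_0_compat; lra).
  apply Rmult_le_reg_r with (1 := P3).
  unfold Rdiv. rewrite Rmult_assoc, Rinv_l, Rmult_1_r by lra.
  rewrite (Rmult_comm eps), !Rmult_assoc. apply Rmult_le_compat_l; [lra|].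
  apply Rle_trans with (eps * Cmod z ^ 3 / 2); [lra|].
  replace (eps * Cmod z ^ 3 / 2) with (eps * Cmod z * Cmod z * (Cmod z / 2)) by field.
  replace (eps * (Cmod z * (Cmod z * Cmod w))) with (eps * Cmod z * Cmod z * Cmod w) by ring.
  apply Rmult_le_compat_l; [|lra]. repeat apply Rmult_le_pos; lra.
Qed.

(** The Cauchy-Riemann equations for total derivatives: the real differential is multiplication by
    [l]. *)
Lemma cderiv_Re_Im f (x y : R) l : cderiv f (x, y) l ->
  differentiable_pt_lim (fun u v => Re (f (u, v))) x y (Re l) (- Im l) /\
  differentiable_pt_lim (fun u v => Im (f (u, v))) x y (Im l) (Re l).
Proof.
  intros H. pose proof (proj1 (cderivE _ _ _) H) as H'. clear H.
  assert (K : forall eps : posreal, locally_2d (fun u v =>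
     Cmod (f (u, v) - f (x, y) - ((u, v) - (x, y)) * l) <=
     eps * Rmax (Rabs (u - x)) (Rabs (v - y))) x y).
  { intros eps. destruct (H' (eps / 2)) as (d & d0 & Hd).
    { destruct eps; simpl; lra. }
    assert (Hd2 : 0 < d / 2) by lra. exists (mkposreal _ Hd2). simpl. intros u v Hu Hv.
    pose proof (Cmod_2Rmax ((u, v) - (x, y))%C) as M. simpl in M.
    fold (u - x) (v - y) in M.
    assert (S2 : sqrt 2 <= 2).
    { rewrite <- (sqrt_Rsqr 2) at 2 by lra. apply sqrt_le_1_alt. unfold Rsqr; lra. }
    assert (S0 := sqrt_pos 2).
    set (m := Rmax (Rabs (u - x)) (Rabs (v - y))) in *.
    assert (m0 : 0 <= m).
    { apply Rle_trans with (Rabs (u - x)); [apply Rabs_pos|apply Rmax_l]. }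
    assert (md : m < d / 2) by (apply Rmax_lub_lt; trivial).
    assert (M2 : Cmod ((u, v) - (x, y)) <= 2 * m) by nra.
    eapply Rle_trans; [apply Hd; lra|].
    destruct eps as [e e0]; simpl in *. nra. }
  split; intros eps; destruct (K eps) as [d Hd]; exists d; intros u v Hu Hv;
    specialize (Hd u v Hu Hv); (eapply Rle_trans; [|exact Hd]).
  - eapply Rle_trans; [|apply re_le_Cmod]. right. f_equal.
    unfold Re, Im; simpl. ring.
  - eapply Rle_trans; [|eapply Rle_trans; [apply Rmax_r|apply Rmax_Cmod]]. right. f_equal.
    unfold Re, Im; simpl. ring.
Qed.

Lemma differentiable_pt_lim_snd (f : R -> R) (x y l : R) :
  derivable_pt_lim f y l -> differentiable_pt_lim (fun _ v => f v) x y 0 l.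
Proof.
  intros H eps.
  destruct (differentiable_pt_lim_proj1_0 f y x l H eps) as [d Hd].
  exists d. intros u v Hu Hv. specialize (Hd v u Hv Hu). simpl in Hd.
  rewrite Rmax_comm. eapply Rle_trans; [|exact Hd]. right; f_equal; ring.
Qed.

Lemma differentiable_pt_lim_mult2 (x y : R) : differentiable_pt_lim Rmult x y y x.
Proof.
  intros eps. exists eps. intros u v Hu Hv.
  replace (u * v - x * y - (y * (u - x) + x * (v - y))) with ((u - x) * (v - y)) by ring.
  rewrite Rabs_mult. apply Rmult_le_compat; try apply Rabs_pos; [lra|apply Rmax_r].
Qed.

Lemma differentiable_pt_lim_mult (f g : R -> R -> R) (x y fx fy gx gy : R) :
  differentiable_pt_lim f x y fx fy -> differentiable_pt_lim g x y gx gy ->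
  differentiable_pt_lim (fun u v => f u v * g u v) x y
    (g x y * fx + f x y * gx) (g x y * fy + f x y * gy).
Proof.
  intros Hf Hg. apply (differentiable_pt_lim_comp Rmult f g); trivial.
  apply differentiable_pt_lim_mult2.
Qed.

(** * Circular means *)

Definition polar (r t : R) : C := (r * cos t, r * sin t).

Lemma Cmod_polar (r t : R) : 0 <= r -> Cmod (polar r t) = r.
Proof.
  intros Hr. unfold Cmod, polar; simpl.
  replace (_ + _) with (r * r).
  - apply sqrt_square, Hr.
  - pose proof (sin2_cos2 t) as E. unfold Rsqr in E. nra.
Qed.

Lemma differentiable_pt_lim_polar (f : R -> R -> R) (r t lx ly : R) :
  differentiable_pt_lim f (r * cos t) (r * sin t) lx ly ->
  differentiable_pt_lim (fun r t => f (r * cos t) (r * sin t)) r t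
    (lx * cos t + ly * sin t) (lx * (r * - sin t) + ly * (r * cos t)).
Proof.
  intros H.
  assert (Hid : differentiable_pt_lim (fun u _ => u) r t 1 0).
  { apply (differentiable_pt_lim_proj1_0 (fun u => u)). apply derivable_pt_lim_id. }
  assert (Hc := differentiable_pt_lim_mult _ _ _ _ _ _ _ _ Hid
    (differentiable_pt_lim_snd cos r t _ (derivable_pt_lim_cos t))).
  assert (Hs := differentiable_pt_lim_mult _ _ _ _ _ _ _ _ Hid
    (differentiable_pt_lim_snd sin r t _ (derivable_pt_lim_sin t))).
  pose proof (differentiable_pt_lim_comp _ _ _ _ _ _ _ _ _ _ _ H Hc Hs) as K.
  simpl in K.
  replace (lx * cos t + ly * sin t) with
    (lx * (cos t * 1 + r * 0) + ly * (sin t * 1 + r * 0)) by ring.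
  replace (lx * (r * - sin t) + ly * (r * cos t)) with
    (lx * (cos t * 0 + r * - sin t) + ly * (sin t * 0 + r * cos t)) by ring.
  exact K.
Qed.

(* The form is the imaginary part of [g dz / z] in polar coordinates. *)
Lemma closed_form_on_polar (g dg : C -> C) (a b c d : R) :
  0 < a -> (forall z, a <= Cmod z <= b -> cderiv g z (dg z)) ->
  closed_form_on (fun r t => Im (g (polar r t)) * / r) (fun r t => Re (g (polar r t))) a b c d.
Proof.
  intros Ha Hg r t Hr Ht.
  destruct (cderiv_Re_Im g (r * cos t) (r * sin t) (dg (polar r t))) as [HR HI].
  { apply Hg. fold (polar r t). rewrite Cmod_polar; lra. }
  apply differentiable_pt_lim_polar in HR, HI.
  assert (Hinv : differentiable_pt_lim (fun u _ => / u) r t (- 1 / r ^ 2) 0).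
  { apply (differentiable_pt_lim_proj1_0 Rinv). apply is_derive_Reals.
    auto_derive; [lra|field; lra]. }
  pose proof (differentiable_pt_lim_mult _ _ _ _ _ _ _ _ HI Hinv) as HP. cbv beta in HP.
  set (l := dg (polar r t)) in *.
  eexists _, _, _. split; [exact HP|].
  (* Closedness amounts to the polar Cauchy-Riemann equation: the [r]-derivative of [Re g] is
     [1 / r] times the [t]-derivative of [Im g]. *)
  match type of HR with differentiable_pt_lim _ _ _ ?A ?B =>
    match goal with |- differentiable_pt_lim _ _ _ ?A' _ => replace A' with A end end.
  - exact HR.
  - field. lra.
Qed.

(** On [[r, rho] x [-PI, PI]] the radial sides cancel by periodicity, so the integrals over the
    circles of radii [r] and [rho] agree; letting [r] tend to 0 identifies them. Working on the
    punctured disc allows [g] to be built from a kernel with a pole. *)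
Lemma circle_mean (g dg : C -> C) (L rho : R) :
  (forall z, 0 < Cmod z < 1 -> cderiv g z (dg z)) ->
  (forall eps, 0 < eps -> exists d, 0 < d /\
     forall z, 0 < Cmod z < d -> Rabs (Re (g z) - L) <= eps) ->
  0 < rho < 1 ->
  is_RInt (fun t => Re (g (polar rho t))) (- PI) PI (2 * PI * L).
Proof.
  intros Hg HL Hr. pose proof PI_RGT_0 as Hpi.
  assert (Hcl : forall r, 0 < r <= rho -> closed_form_on (fun r t => Im (g (polar r t)) * / r)
     (fun r t => Re (g (polar r t))) r rho (- PI) PI).
  { intros r Hr'. apply closed_form_on_polar with dg; [lra|]. intros z Hz. apply Hg. lra. }
  assert (Hex : forall r, 0 < r <= rho -> ex_RInt (fun t => Re (g (polar r t))) (- PI) PI).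
  { intros r Hr'. apply (proj2 (closed_form_on_ex_RInt _ _ _ _ _ _ (Hcl r Hr'))); lra. }
  assert (Hconst : forall r, 0 < r <= rho ->
     RInt (fun t => Re (g (polar rho t))) (- PI) PI = RInt (fun t => Re (g (polar r t))) (- PI) PI).
  { intros r Hr'.
    pose proof (rect_circulation_zero _ _ r rho (- PI) PI ltac:(lra) ltac:(lra) (Hcl r Hr')) as E.
    unfold rect_circulation in E.
    rewrite (RInt_ext (fun s => Im (g (polar s (- PI))) * / s)
       (fun s => Im (g (polar s PI)) * / s)) in E.
    - lra.
    - intros s _. unfold polar. rewrite cos_neg, sin_neg, sin_PI, Ropp_0. reflexivity. }
  assert (E : RInt (fun t => Re (g (polar rho t))) (- PI) PI = 2 * PI * L).
  { apply Rminus_diag_uniq. apply cond_eq. intros eps He. rewrite Rminus_0_r.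
    destruct (HL (eps / (4 * PI))) as (d & d0 & Hd).
    { apply Rdiv_lt_0_compat; lra. }
    set (r := Rmin rho (d / 2)).
    assert (Hr' : 0 < r <= rho) by (split; [apply Rmin_pos; lra|apply Rmin_l]).
    assert (Hrd : r < d) by (apply Rle_lt_trans with (d / 2); [apply Rmin_r|lra]).
    rewrite (Hconst r Hr').
    pose proof (RInt_near_affine _ (- PI) PI L 0 (eps / (4 * PI)) ltac:(lra) (Hex r Hr')) as K.
    apply Rle_lt_trans with (eps / (4 * PI) * (PI - - PI)).
    - eapply Rle_trans; [|apply K].
      + right; f_equal. field.
      + intros s _. rewrite Rmult_0_l, Rplus_0_r. apply Hd. rewrite Cmod_polar; lra.
    - replace (eps / (4 * PI) * (PI - - PI)) with (eps / 2) by (field; lra). lra. }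
  rewrite <- E. apply (RInt_correct (V := R_CompleteNormedModule)), Hex. lra.
Qed.

(** * Analytic maps into a strip *)

Definition holomorphic_on_disc (f df : C -> C) : Prop :=
  forall z, in_disc z -> cderiv f z (df z).

Lemma is_RInt_cos_sub (k c a b : R) :
  is_RInt (fun t => k * (cos t - c)) a b (k * (sin b - sin a - c * (b - a))).
Proof.
  evar (v : R). replace (k * (sin b - sin a - c * (b - a))) with v; unfold v.
  - apply (is_RInt_derive (fun t => k * (sin t - c * t))).
    + intros s _. auto_derive; [exact I|ring].
    + intros s _. apply continuity_pt_filterlim. reg.
  - unfold minus, plus, opp; simpl. ring.
Qed.

(* The maximum of [\int u cos] for [|u| <= 1] with prescribed mean [u0] is
   attained by [u = 1] on [|t| < alpha] and [u = -1] elsewhere. *)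
Lemma bang_bang_bound (u : R -> R) (u0 alpha rho : R) :
  0 < rho -> Rabs u0 <= 1 -> alpha = PI * (1 + u0) / 2 ->
  (forall t, Rabs (u t) <= 1) ->
  let k := fun t => (u t - u0) * (2 / rho * (cos t - cos alpha)) in
  ex_RInt k (- PI) PI ->
  RInt k (- PI) PI <= 8 / rho * sin alpha.
Proof.
  intros Hrho Hu0 Ha Hu k Hk. pose proof PI_RGT_0 as Hpi.
  apply Rabs_le_between in Hu0.
  assert (Hal : 0 <= alpha <= PI) by (rewrite Ha; nra).
  assert (Hr2 : 0 < 2 / rho) by (apply Rdiv_lt_0_compat; lra).
  assert (Hk1 : ex_RInt k (- PI) alpha).
  { apply (ex_RInt_Chasles_1 (V := R_CompleteNormedModule)) with PI; [lra|exact Hk]. }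
  assert (Hk2 : ex_RInt k alpha PI).
  { apply (ex_RInt_Chasles_2 (V := R_CompleteNormedModule)) with (- PI); [lra|exact Hk]. }
  assert (Hk3 : ex_RInt k (- PI) (- alpha)).
  { apply (ex_RInt_Chasles_1 (V := R_CompleteNormedModule)) with alpha; [lra|exact Hk1]. }
  assert (Hk4 : ex_RInt k (- alpha) alpha).
  { apply (ex_RInt_Chasles_2 (V := R_CompleteNormedModule)) with (- PI); [lra|exact Hk1]. }
  assert (E1 : RInt k (- PI) PI = RInt k (- PI) (- alpha) + RInt k (- alpha) alpha + RInt k alpha PI).
  { rewrite <- (RInt_Chasles (V := R_CompleteNormedModule) k (- PI) alpha PI Hk1 Hk2).
    rewrite <- (RInt_Chasles (V := R_CompleteNormedModule) k (- PI) (- alpha) alpha Hk3 Hk4).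
    reflexivity. }
  assert (Hcos : forall t, - PI <= t <= PI -> cos t = cos (Rabs t)).
  { intros t _. unfold Rabs. destruct Rcase_abs; [now rewrite cos_neg|reflexivity]. }
  (* Here [cos t - cos alpha] is nonnegative and [u t] is replaced by 1; outside the sign is
     reversed and [u t] is replaced by -1. *)
  assert (In : forall t, - alpha <= t <= alpha -> k t <= (2 / rho * (1 - u0)) * (cos t - cos alpha)).
  { intros t Ht. specialize (Hu t). apply Rabs_le_between in Hu.
    assert (cos alpha <= cos t).
    { rewrite (Hcos t) by lra.
      assert (0 <= Rabs t <= alpha) by (split; [apply Rabs_pos|apply Rabs_le; lra]).
      apply cos_decr_1; lra. }
    unfold k. assert (0 <= 2 / rho * (cos t - cos alpha)) by nra. nra. }
  assert (Out : forall t, - PI <= t <= PI -> alpha <= Rabs t ->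
     k t <= (- (2 / rho) * (1 + u0)) * (cos t - cos alpha)).
  { intros t Ht Hat. specialize (Hu t). apply Rabs_le_between in Hu.
    assert (cos t <= cos alpha).
    { rewrite (Hcos t) by lra.
      assert (Rabs t <= PI) by (apply Rabs_le; lra).
      apply cos_decr_1; lra. }
    unfold k. assert (0 <= 2 / rho * (cos alpha - cos t)) by nra. nra. }
  assert (B1 : RInt k (- PI) (- alpha) <= (- (2 / rho) * (1 + u0)) *
     (sin (- alpha) - sin (- PI) - cos alpha * (- alpha - - PI))).
  { eapply is_RInt_le; [| |apply is_RInt_cos_sub|].
    - lra.
    - apply (RInt_correct (V := R_CompleteNormedModule)), Hk3.
    - intros t Ht. apply Out; [lra|]. rewrite Rabs_left1; lra. }
  assert (B2 : RInt k (- alpha) alpha <= (2 / rho * (1 - u0)) *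
     (sin alpha - sin (- alpha) - cos alpha * (alpha - - alpha))).
  { eapply is_RInt_le; [| |apply is_RInt_cos_sub|].
    - lra.
    - apply (RInt_correct (V := R_CompleteNormedModule)), Hk4.
    - intros t Ht. apply In. lra. }
  assert (B3 : RInt k alpha PI <= (- (2 / rho) * (1 + u0)) *
     (sin PI - sin alpha - cos alpha * (PI - alpha))).
  { eapply is_RInt_le; [| |apply is_RInt_cos_sub|].
    - lra.
    - apply (RInt_correct (V := R_CompleteNormedModule)), Hk2.
    - intros t Ht. apply Out; [lra|]. rewrite Rabs_pos_eq; lra. }
  rewrite !sin_neg, sin_PI in B1. rewrite sin_neg in B2. rewrite sin_PI in B3.
  rewrite E1. eapply Rle_trans; [apply Rplus_le_compat; [apply Rplus_le_compat|]; eassumption|].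
  (* The coefficient of [cos alpha] is a multiple of [PI * (1 + u0) - 2 * alpha], which vanishes by
     the choice of [alpha]. *)
  right. generalize (sin alpha) (cos alpha). intros S Co. rewrite Ha. field. lra.
Qed.

(** The passage [rho -> 1]: if [K < D], the midpoint of [K / D] and 1 is a radius violating the
    bound. *)
Lemma le_of_scaled_le (D K : R) : 0 <= K -> (forall rho, 0 < rho < 1 -> D * rho <= K) -> D <= K.
Proof.
  intros HK H. destruct (Rle_lt_dec D K) as [|Hlt]; [assumption|exfalso].
  assert (Hd : 0 < D) by lra.
  assert (Hkd : 0 <= K / D < 1).
  { split; [apply Rdiv_le_0_compat; lra|]. apply Rmult_lt_reg_r with D; [lra|].
    unfold Rdiv. rewrite Rmult_assoc, Rinv_l; lra. }
  specialize (H ((1 + K / D) / 2) ltac:(lra)).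
  replace (D * ((1 + K / D) / 2)) with ((D + K) / 2) in H by (field; lra). lra.
Qed.

(** On [|z| = rho] one has [1 / z = conj z / rho^2], so the kernel is real there. *)
Lemma polar_kernel (rho t c : R) : 0 < rho ->
  (polar rho t * RtoC (/ rho ^ 2) + / polar rho t + RtoC (- (2 * c / rho)))%C =
  RtoC (2 / rho * (cos t - c)).
Proof.
  intros Hr.
  assert (E : (rho * cos t) ^ 2 + (rho * sin t) ^ 2 = rho ^ 2).
  { pose proof (sin2_cos2 t) as E. unfold Rsqr in E. nra. }
  unfold polar, RtoC, Cinv, Cplus, Cmult. cbn [fst snd]. rewrite E.
  apply injective_projections; simpl; field; lra.
Qed.

(** The simple pole of the kernel extracts [df 0] as the limit of [g] at 0, while its reality on the
    circle leaves only [Re f] under the integral, to be bounded by [bang_bang_bound]. *)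
Lemma strip_deriv0_Re (f df : C -> C) :
  holomorphic_on_disc f df -> (forall z, in_disc z -> Rabs (Re (f z)) <= 1) ->
  Re (df 0%C) <= 4 / PI * cos (PI / 2 * Re (f 0%C)).
Proof.
  intros Hf Hb. pose proof PI_RGT_0 as Hpi.
  assert (D0 : in_disc 0%C) by (unfold in_disc; rewrite Cmod_0; lra).
  set (u0 := Re (f 0%C)). assert (Hu0 : Rabs u0 <= 1) by (apply Hb, D0).
  set (alpha := PI * (1 + u0) / 2).
  replace (cos (PI / 2 * u0)) with (sin alpha).
  2:{ rewrite <- (sin_shift (PI / 2 * u0)), <- (sin_PI_x alpha).
      f_equal. unfold alpha. field. }
  assert (Hu0' := proj1 (Rabs_le_between _ _) Hu0).
  assert (Hs : 0 <= sin alpha) by (apply sin_ge_0; unfold alpha; nra).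
  apply le_of_scaled_le.
  { apply Rmult_le_pos; [apply Rdiv_le_0_compat; lra|exact Hs]. }
  intros rho Hr.
  set (kr := fun z : C => (z * RtoC (/ rho ^ 2) + / z + RtoC (- (2 * cos alpha / rho)))%C).
  set (g := fun z : C => ((f z + - f 0%C) * kr z)%C).
  assert (Hg : exists dg, forall z, 0 < Cmod z < 1 -> cderiv g z (dg z)).
  { eexists. intros z Hz. unfold g, kr.
    apply (cderiv_mult (fun z => f z + - f 0%C)%C).
    - apply cderiv_plus; [apply Hf; unfold in_disc; lra|apply cderiv_const].
    - apply (cderiv_plus (fun z => z * RtoC (/ rho ^ 2) + / z)%C); [|apply cderiv_const].
      apply (cderiv_plus (fun z => z * RtoC (/ rho ^ 2))%C).
      + apply (cderiv_mult (fun z => z)); [apply cderiv_id|apply cderiv_const].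
      + apply cderiv_inv. apply Cmod_gt_0. lra. }
  destruct Hg as [dg Hg].
  assert (HL : forall eps, 0 < eps -> exists d, 0 < d /\
     forall z, 0 < Cmod z < d -> Rabs (Re (g z) - Re (df 0%C)) <= eps).
  { intros eps He. set (l := df 0%C).
    pose proof (proj1 (cderivE _ _ _) (Hf 0%C D0)) as K. fold l in K.
    (* The bound [eps / 2] controls [e / z]; the bound 1 gives [|e| <= |z|], so that
       [|f z - f 0| <= (1 + |l|) |z|]. *)
    destruct (K (Rmin (eps / 2) 1)) as (d & d0 & Hd); [apply Rmin_pos; lra|].
    set (M := (1 + Cmod l) * (/ rho ^ 2 + 2 / rho)).
    assert (Hl := Cmod_ge_0 l).
    assert (Hr2 : 0 < / rho ^ 2) by (apply Rinv_0_lt_compat, pow_lt; lra).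
    assert (Hr1 : 0 < 2 / rho) by (apply Rdiv_lt_0_compat; lra).
    assert (HM : 0 < M) by (apply Rmult_lt_0_compat; lra).
    exists (Rmin d (Rmin 1 (eps / (2 * M)))). split.
    { repeat apply Rmin_pos; try lra. apply Rdiv_lt_0_compat; lra. }
    intros z [Hz0 Hz].
    assert (Hz1 := Rlt_le_trans _ _ _ Hz (Rmin_l _ _)).
    assert (Hz2 := Rlt_le_trans _ _ _ Hz (Rmin_r _ _)).
    assert (Hz3 := Rlt_le_trans _ _ _ Hz2 (Rmin_l _ _)).
    assert (Hz4 := Rlt_le_trans _ _ _ Hz2 (Rmin_r _ _)). clear Hz Hz2.
    assert (Nz : z <> 0%C) by (apply Cmod_gt_0; lra).
    replace (z - 0)%C with z in Hd by ring.
    specialize (Hd z). replace (z - 0)%C with z in Hd by ring. specialize (Hd Hz1).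
    set (e := (f z - f 0 - z * l)%C) in *.
    assert (He1 : Cmod e <= eps / 2 * Cmod z).
    { eapply Rle_trans; [exact Hd|]. apply Rmult_le_compat_r; [lra|apply Rmin_l]. }
    assert (He2 : Cmod e <= Cmod z).
    { eapply Rle_trans; [exact Hd|]. rewrite <- (Rmult_1_l (Cmod z)) at 2.
      apply Rmult_le_compat_r; [lra|apply Rmin_r]. }
    replace (Re (g z) - Re l) with (Re (g z - l)%C) by (unfold Re; simpl; ring).
    eapply Rle_trans; [apply re_le_Cmod|].
    (* With [f z - f 0 = z l + e], the pole contributes [l + e / z] and the regular part of the
       kernel the other product. *)
    replace (g z - l)%C with
      ((z * l + e) * (z * RtoC (/ rho ^ 2) + RtoC (- (2 * cos alpha / rho))) + e / z)%C.
    2:{ unfold g, kr, e. field. exact Nz. }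
    eapply Rle_trans; [apply Cmod_triangle|].
    rewrite Cmod_mult, Cmod_div by exact Nz.
    assert (A1 : Cmod (z * l + e) <= (1 + Cmod l) * Cmod z).
    { eapply Rle_trans; [apply Cmod_triangle|]. rewrite Cmod_mult. lra. }
    assert (A2 : Cmod (z * RtoC (/ rho ^ 2) + RtoC (- (2 * cos alpha / rho))) <= / rho ^ 2 + 2 / rho).
    { eapply Rle_trans; [apply Cmod_triangle|]. rewrite Cmod_mult, !Cmod_R.
      rewrite Rabs_Ropp, (Rabs_pos_eq (/ rho ^ 2)) by lra.
      replace (2 * cos alpha / rho) with (2 / rho * cos alpha) by (field; lra).
      rewrite Rabs_mult, (Rabs_pos_eq (2 / rho)) by lra.
      pose proof (COS_bound alpha).
      assert (Rabs (cos alpha) <= 1) by (apply Rabs_le; lra).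
      apply Rplus_le_compat; nra. }
    assert (A3 : Cmod e / Cmod z <= eps / 2).
    { apply Rmult_le_reg_r with (Cmod z); [lra|]. unfold Rdiv at 1.
      rewrite Rmult_assoc, Rinv_l by lra. lra. }
    assert (A4 : M * Cmod z <= eps / 2).
    { apply Rlt_le. apply (Rmult_lt_compat_l M) in Hz4; [|lra].
      replace (M * (eps / (2 * M))) with (eps / 2) in Hz4 by (field; lra). exact Hz4. }
    assert (A5 := Rmult_le_compat _ _ _ _ (Cmod_ge_0 _) (Cmod_ge_0 _) A1 A2).
    unfold M in A4. lra. }
  pose proof (circle_mean g dg _ rho Hg HL Hr) as HI.
  set (u := fun t => Re (f (polar rho t))).
  assert (HI' : is_RInt (fun t => (u t - u0) * (2 / rho * (cos t - cos alpha))) (- PI) PI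
    (2 * PI * Re (df 0%C))).
  { eapply is_RInt_ext; [|exact HI]. intros t _. unfold g, kr.
    rewrite polar_kernel by lra. unfold u, u0, Re, RtoC; simpl. ring. }
  pose proof (bang_bang_bound u u0 alpha rho ltac:(lra) Hu0 eq_refl) as B.
  cbv zeta in B.
  assert (B' := B ltac:(intros t; apply Hb; unfold in_disc; rewrite Cmod_polar; lra)
    (ex_intro _ _ HI')).
  rewrite (is_RInt_unique _ _ _ _ HI') in B'.
  apply Rmult_le_reg_r with (2 * PI / rho); [apply Rdiv_lt_0_compat; lra|].
  replace (Re (df 0%C) * rho * (2 * PI / rho)) with (2 * PI * Re (df 0%C)) by (field; lra).
  eapply Rle_trans; [exact B'|]. right. field. lra.
Qed.

(** * Rotations, disc automorphisms and the Schwarz-Pick inequality for the strip *)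

Lemma unimodular_phase (w : C) : exists e : C, Cmod e = 1 /\ (e * w)%C = RtoC (Cmod w).
Proof.
  destruct (Req_dec (Cmod w) 0) as [E|N].
  - exists 1%C. rewrite E, (Cmod_eq_0 _ E). split; [apply Cmod_1|ring].
  - exists (Cconj w / RtoC (Cmod w))%C.
    assert (N' : RtoC (Cmod w) <> 0%C) by (intros H; apply N; now apply RtoC_inj in H).
    split.
    + rewrite Cmod_div, Cmod_conj, Cmod_R, Rabs_pos_eq by (trivial; apply Cmod_ge_0).
      field; exact N.
    + replace (Cconj w / Cmod w * w)%C with ((w * Cconj w) / Cmod w)%C by (field; exact N').
      rewrite <- Cmod2_conj, RtoC_pow. field. exact N'.
Qed.

(** Precomposition with a rotation [z -> e z] fixes [f 0] and multiplies the derivative at 0 by [e],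
    which can be chosen to make it equal to its modulus. *)
Lemma strip_deriv0 (f df : C -> C) :
  holomorphic_on_disc f df -> (forall z, in_disc z -> Rabs (Re (f z)) <= 1) ->
  Cmod (df 0%C) <= 4 / PI * cos (PI / 2 * Re (f 0%C)).
Proof.
  intros Hf Hb. destruct (unimodular_phase (df 0%C)) as (e & He & Ee).
  assert (Hrot : forall z, in_disc z -> in_disc (e * z)%C).
  { intros z Hz. unfold in_disc in *. rewrite Cmod_mult, He. lra. }
  pose proof (strip_deriv0_Re (fun z => f (e * z)%C) (fun z => (e * df (e * z))%C)) as K.
  cbv beta in K. replace (e * 0)%C with (RtoC 0) in K by ring.
  rewrite Ee in K. apply K.
  - intros z Hz. apply (cderiv_comp f (fun z => e * z)%C); [apply Hf, Hrot, Hz|].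
    eapply cderiv_eq; [apply cderiv_cmul, cderiv_id|ring].
  - intros z Hz. apply Hb, Hrot, Hz.
Qed.

(** Rests on [|1 + conj a z|^2 - |z + a|^2 = (1 - |a|^2) (1 - |z|^2)]. *)
Lemma disc_moebius (a z : C) : in_disc a -> in_disc z ->
  (1 + Cconj a * z)%C <> 0%C /\ in_disc ((z + a) / (1 + Cconj a * z))%C.
Proof.
  unfold in_disc. intros Ha Hz.
  assert (Ha0 := Cmod_ge_0 a). assert (Hz0 := Cmod_ge_0 z).
  assert (N : (1 + Cconj a * z)%C <> 0%C).
  { apply Cmod_gt_0. pose proof (Cmod_triangle (1 + Cconj a * z) (- (Cconj a * z))) as T.
    replace (1 + Cconj a * z + - (Cconj a * z))%C with (RtoC 1) in T by ring.
    rewrite Cmod_1, Cmod_opp, Cmod_mult, Cmod_conj in T. nra. }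
  split; [exact N|].
  assert (P := proj1 (Cmod_gt_0 _) N).
  rewrite Cmod_div by exact N.
  apply Rmult_lt_reg_r with (1 := P). unfold Rdiv.
  rewrite Rmult_assoc, Rinv_l, Rmult_1_r, Rmult_1_l by lra.
  apply Rsqr_incrst_0; [|apply Cmod_ge_0|lra]. rewrite !Rsqr_pow2.
  assert (E : Cmod (1 + Cconj a * z) ^ 2 - Cmod (z + a) ^ 2 = (1 - Cmod a ^ 2) * (1 - Cmod z ^ 2)).
  { rewrite !Cmod2_alt. unfold Re, Im. destruct a, z. simpl. ring. }
  assert (0 < (1 - Cmod a ^ 2) * (1 - Cmod z ^ 2)) by (apply Rmult_lt_0_compat; nra). lra.
Qed.

(** The estimate at the centre applied to [f o phi], where the automorphism [phi] has [phi 0 = a]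
    and [phi' 0 = 1 - |a|^2]. *)
Lemma strip_schwarz_pick (f df : C -> C) (a : C) :
  holomorphic_on_disc f df -> (forall z, in_disc z -> Rabs (Re (f z)) <= 1) -> in_disc a ->
  Cmod (df a) * (1 - Cmod a ^ 2) <= 4 / PI * cos (PI / 2 * Re (f a)).
Proof.
  intros Hf Hb Ha.
  set (phi := fun z : C => ((z + a) / (1 + Cconj a * z))%C).
  set (dphi := fun z : C => (1 * / (1 + Cconj a * z)
    + (z + a) * (Cconj a * - / ((1 + Cconj a * z) * (1 + Cconj a * z))))%C).
  assert (Hphi : forall z, in_disc z -> cderiv phi z (dphi z)).
  { intros z Hz. destruct (disc_moebius a z Ha Hz) as [N _].
    unfold phi, dphi. apply (cderiv_mult (fun z => z + a)%C (fun z => / (1 + Cconj a * z))%C).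
    - eapply cderiv_eq; [apply cderiv_plus; [apply cderiv_id|apply cderiv_const]|ring].
    - apply (cderiv_comp Cinv (fun z => 1 + Cconj a * z)%C).
      + apply cderiv_inv, N.
      + eapply cderiv_eq; [apply cderiv_plus; [apply cderiv_const|apply cderiv_cmul, cderiv_id]|ring]. }
  assert (E0 : phi 0%C = a) by (unfold phi; field).
  pose proof (strip_deriv0 (fun z => f (phi z)) (fun z => dphi z * df (phi z))%C) as K.
  cbv beta in K. rewrite E0 in K.
  replace (dphi 0%C) with (RtoC (1 - Cmod a ^ 2)) in K.
  - rewrite Cmod_mult, Cmod_R, Rabs_pos_eq in K.
    2:{ assert (H0 := Cmod_ge_0 a). unfold in_disc in Ha. nra. }
    rewrite Rmult_comm. apply K.
    + intros z Hz. apply cderiv_comp; [|apply Hphi, Hz]. apply Hf. now apply disc_moebius.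
    + intros z Hz. apply Hb. now apply disc_moebius.
  - unfold dphi. rewrite RtoC_minus, RtoC_pow.
    replace (RtoC (Cmod a) ^ 2)%C with (a * Cconj a)%C.
    + field.
    + rewrite <- Cmod2_conj. now rewrite RtoC_pow.
Qed.

(** * Growth of the real part along radii *)

Lemma cderiv_directional (f : C -> C) (p d l : C) (t : R) :
  cderiv f (p + d * RtoC t)%C l ->
  is_derive (fun s => Re (f (p + d * RtoC s)%C)) t (Re (d * l)%C) /\
  is_derive (fun s => Im (f (p + d * RtoC s)%C)) t (Im (d * l)%C).
Proof.
  intros H.
  replace (p + d * RtoC t)%C with ((fst p + fst d * t, snd p + snd d * t) : C) in H.
  2:{ apply injective_projections; simpl; ring. }
  destruct (cderiv_Re_Im _ _ _ _ H) as [HR HI].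
  assert (Hl : forall u v : R, derivable_pt_lim (fun s => u + v * s) t v).
  { intros u v. apply is_derive_Reals. auto_derive; [exact I|ring]. }
  assert (E : forall s : R, (p + d * RtoC s)%C = ((fst p + fst d * s, snd p + snd d * s) : C)).
  { intros s. apply injective_projections; simpl; ring. }
  split.
  - apply is_derive_ext with (fun s => Re (f ((fst p + fst d * s, snd p + snd d * s) : C))).
    { intros s. now rewrite E. }
    apply is_derive_Reals.
    replace (Re (d * l)%C) with (Re l * fst d + - Im l * snd d) by (unfold Re, Im; simpl; ring).
    apply (derivable_pt_lim_comp_2d (fun u v => Re (f (u, v)))); trivial.
  - apply is_derive_ext with (fun s => Im (f ((fst p + fst d * s, snd p + snd d * s) : C))).
    { intros s. now rewrite E. }
    apply is_derive_Reals.
    replace (Im (d * l)%C) with (Im l * fst d + Re l * snd d) by (unfold Re, Im; simpl; ring).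
    apply (derivable_pt_lim_comp_2d (fun u v => Im (f (u, v)))); trivial.
Qed.

(** The numerator is the defect in [T' (1 - s^2) <= 1 - T^2], so that inequality makes the quotient
    nonincreasing. *)
Lemma is_derive_pseudo_hyperbolic_diff (T : R -> R) (s l : R) :
  is_derive T s l -> 1 - s * T s <> 0 ->
  is_derive (fun s => (T s - s) / (1 - s * T s)) s
    ((l * (1 - s ^ 2) - (1 - T s ^ 2)) / (1 - s * T s) ^ 2).
Proof.
  intros HT Hden. assert (HTe : ex_derive T s) by (exists l; exact HT).
  auto_derive.
  - repeat split; trivial.
  - replace (Derive (fun x => T x) s) with l by (symmetry; apply is_derive_unique, HT).
    field. exact Hden.
Qed.

(** With [T = tan (PI U / 4)], Schwarz-Pick along the radius becomes [T' (1 - s^2) <= 1 - T^2], with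
    equality for [T = s]; comparison from [T 0 = 0] gives [T x <= x]. *)
Lemma strip_growth_radial (f df : C -> C) (e : C) (x : R) :
  holomorphic_on_disc f df -> (forall z, in_disc z -> Rabs (Re (f z)) < 1) ->
  Re (f 0%C) = 0 -> Cmod e = 1 -> 0 <= x < 1 ->
  Re (f (e * RtoC x)%C) <= 4 / PI * atan x.
Proof.
  intros Hf Hb H0 He Hx. pose proof PI_RGT_0 as Hpi.
  set (U := fun s => Re (f (e * RtoC s)%C)).
  assert (Hm : forall s, 0 <= s -> Cmod (e * RtoC s)%C = s).
  { intros s Hs. rewrite Cmod_mult, He, Cmod_R, Rabs_pos_eq; lra. }
  assert (HD : forall s, 0 <= s <= x -> in_disc (e * RtoC s)%C).
  { intros s Hs. unfold in_disc. rewrite Hm; lra. }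
  set (V := fun s => Re (e * df (e * RtoC s))%C).
  assert (HU : forall s, 0 <= s <= x -> is_derive U s (V s)).
  { intros s Hs. destruct (cderiv_directional f 0%C e (df (e * RtoC s)%C) s) as [K _].
    { rewrite Cplus_0_l. apply Hf, HD, Hs. }
    apply is_derive_ext with (2 := K). intros t. now rewrite Cplus_0_l. }
  assert (HV : forall s, 0 <= s <= x -> V s * (1 - s ^ 2) <= 4 / PI * cos (PI / 2 * U s)).
  { intros s Hs.
    eapply Rle_trans; [|apply (strip_schwarz_pick f df (e * RtoC s)%C Hf)].
    - rewrite Hm by lra. apply Rmult_le_compat_r; [nra|].
      eapply Rle_trans; [apply Rle_abs|]. eapply Rle_trans; [apply re_le_Cmod|].
      rewrite Cmod_mult, He. lra.
    - intros z Hz. apply Rlt_le, Hb, Hz.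
    - apply HD, Hs. }
  assert (HUb : forall s, 0 <= s <= x -> -1 < U s < 1).
  { intros s Hs. pose proof (Rabs_def2 _ _ (Hb _ (HD s Hs))) as K. unfold U. lra. }
  set (th := fun s => PI / 4 * U s).
  assert (Hth : forall s, 0 <= s <= x -> - (PI / 4) < th s < PI / 4).
  { intros s Hs. specialize (HUb s Hs). unfold th. nra. }
  assert (Hcos : forall s, 0 <= s <= x -> 0 < cos (th s)).
  { intros s Hs. specialize (Hth s Hs). apply cos_gt_0; lra. }
  set (T := fun s => tan (th s)).
  set (dT := fun s => (1 + T s ^ 2) * (PI / 4 * V s)).
  assert (HT : forall s, 0 <= s <= x -> is_derive T s (dT s)).
  { intros s Hs. unfold dT, T, th. specialize (Hcos s Hs). unfold th in Hcos.
    assert (HD1 : is_derive (fun s => PI / 4 * U s) s (PI / 4 * V s)).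
    { apply is_derive_scal, HU, Hs. }
    rewrite Rmult_comm.
    apply (is_derive_comp tan (fun s => PI / 4 * U s)); [|exact HD1].
    rewrite Rplus_comm. apply is_derive_tan. lra. }
  assert (HTb : forall s, 0 <= s <= x -> -1 < T s < 1).
  { intros s Hs. specialize (Hth s Hs). unfold T.
    assert (Hn : tan (- (PI / 4)) = -1) by (rewrite tan_neg, tan_PI4; ring).
    split; [rewrite <- Hn|rewrite <- tan_PI4]; apply tan_increasing; lra. }
  (* The angle in Schwarz-Pick is [2 th], with [cos (2 th) = cos^2 th (1 - T^2)]; the factor
     [1 + T^2] in [dT] cancels [cos^2 th]. *)
  assert (Hode : forall s, 0 <= s <= x -> dT s * (1 - s ^ 2) <= 1 - T s ^ 2).
  { intros s Hs. specialize (HV s Hs). specialize (Hcos s Hs).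
    replace (PI / 2 * U s) with (2 * th s) in HV by (unfold th; field).
    rewrite cos_2a in HV. unfold dT.
    assert (E1 : T s * cos (th s) = sin (th s)).
    { unfold T, tan. field. lra. }
    assert (E2 : (1 + T s ^ 2) * (cos (th s) * cos (th s)) = 1).
    { pose proof (sin2_cos2 (th s)) as E. unfold Rsqr in E. rewrite <- E1 in E. lra. }
    rewrite <- E1 in HV.
    apply (Rmult_le_compat_l (PI / 4 * (1 + T s ^ 2))) in HV; [|nra].
    replace (PI / 4 * (1 + T s ^ 2) * (4 / PI * (cos (th s) * cos (th s)
       - T s * cos (th s) * (T s * cos (th s)))))
      with ((1 + T s ^ 2) * (cos (th s) * cos (th s)) * (1 - T s ^ 2)) in HV by (field; lra).
    rewrite E2 in HV. lra. }
  assert (Hden : forall s, 0 <= s <= x -> 0 < 1 - s * T s).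
  { intros s Hs. specialize (HTb s Hs). nra. }
  (* The pseudo-hyperbolic difference of [T s] and [s] is nonincreasing. *)
  set (S := fun s => (T s - s) / (1 - s * T s)).
  set (dS := fun s => (dT s * (1 - s ^ 2) - (1 - T s ^ 2)) / (1 - s * T s) ^ 2).
  assert (HS : forall s, 0 <= s <= x -> is_derive S s (dS s)).
  { intros s Hs. specialize (Hden s Hs).
    apply is_derive_pseudo_hyperbolic_diff; [apply HT, Hs|lra]. }
  destruct (MVT_gen S 0 x dS) as (c & Hc & E).
  { intros s Hs. rewrite Rmin_left, Rmax_right in Hs by lra. apply HS. lra. }
  { intros s Hs. rewrite Rmin_left, Rmax_right in Hs by lra.
    apply continuity_pt_filterlim, (@ex_derive_continuous R_AbsRing R_NormedModule).
    exists (dS s). apply HS. lra. }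
  rewrite Rmin_left, Rmax_right in Hc by lra.
  assert (S0 : S 0 = 0).
  { unfold S, T, th, U. replace (e * RtoC 0)%C with (RtoC 0) by ring. rewrite H0, Rmult_0_r, tan_0. field. }
  assert (dS0 : dS c <= 0).
  { specialize (Hode c Hc). specialize (Hden c Hc). unfold dS, Rdiv.
    assert (0 < / (1 - c * T c) ^ 2) by (apply Rinv_0_lt_compat, pow_lt; lra). nra. }
  assert (Sx : S x <= 0) by (rewrite S0 in E; nra).
  assert (Hx' : 0 <= x <= x) by lra.
  assert (Tx : T x <= x).
  { specialize (Hden x Hx'). unfold S in Sx.
    apply Rminus_le. apply Rmult_le_reg_r with (/ (1 - x * T x)).
    - apply Rinv_0_lt_compat; lra.
    - rewrite Rmult_0_l. exact Sx. }
  specialize (Hth x Hx').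
  assert (Ath : th x <= atan x).
  { rewrite <- (atan_tan (th x)) by lra. fold (T x).
    destruct (Rle_lt_or_eq_dec _ _ Tx) as [L| ->]; [apply Rlt_le, atan_increasing, L|lra]. }
  fold (U x). replace (U x) with (4 / PI * th x) by (unfold th; field; lra).
  apply Rmult_le_compat_l; [apply Rdiv_le_0_compat; lra|exact Ath].
Qed.

(** * Harmonic and biharmonic maps *)

Lemma Cmod1_conj (e : C) : Cmod e = 1 -> (e * Cconj e)%C = RtoC 1.
Proof. intros H. rewrite <- Cmod2_conj, H. f_equal; ring. Qed.

Lemma unimodular_polar (z : C) : exists e : C, Cmod e = 1 /\ z = (e * RtoC (Cmod z))%C.
Proof.
  destruct (unimodular_phase z) as (e & He & E). exists (Cconj e). split.
  - now rewrite Cmod_conj.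
  - rewrite <- E, Cmult_assoc, (Cmult_comm (Cconj e)), (Cmod1_conj _ He). ring.
Qed.

(** Normalising [1 + p] works since [1 + p = p (1 + conj p)] on the unit circle; for [p = -1] the
    root is [Ci]. *)
Lemma unimodular_sqrt (p : C) : Cmod p = 1 -> exists e : C, Cmod e = 1 /\ (e * e)%C = p.
Proof.
  intros Hp. pose proof (Cmod1_conj p Hp) as Ep.
  destruct (Req_dec (Cmod (1 + p)) 0) as [E0|N].
  - exists Ci. split; [apply Cmod_Ci|]. apply Cmod_eq_0 in E0.
    replace p with (1 + p - 1)%C by ring. rewrite E0.
    apply injective_projections; simpl; ring.
  - assert (N' : RtoC (Cmod (1 + p)) <> RtoC 0) by (intros H; apply N; now apply RtoC_inj in H).
    exists ((1 + p) / RtoC (Cmod (1 + p)))%C. split.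
    + rewrite Cmod_div, Cmod_R, Rabs_pos_eq by (trivial; apply Cmod_ge_0). field. exact N.
    + assert (E2 : (RtoC (Cmod (1 + p)) * RtoC (Cmod (1 + p)) = (1 + p) * (1 + Cconj p))%C).
      { rewrite <- RtoC_mult. replace (Cmod (1 + p) * Cmod (1 + p)) with (Cmod (1 + p) ^ 2) by ring.
        rewrite Cmod2_conj. f_equal. apply injective_projections; simpl; ring. }
      replace ((1 + p) / Cmod (1 + p) * ((1 + p) / Cmod (1 + p)))%C with
        ((1 + p) * (1 + p) / (RtoC (Cmod (1 + p)) * RtoC (Cmod (1 + p))))%C by (field; exact N').
      rewrite E2.
      assert (N1 : (1 + p)%C <> RtoC 0) by (intros H; apply N; rewrite H; apply Cmod_0).
      assert (N2 : (1 + Cconj p)%C <> RtoC 0).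
      { intros H. apply (Cmult_neq_0 _ _ N' N'). rewrite E2, H. ring. }
      replace (1 + p)%C with (p * (1 + Cconj p))%C at 2.
      * field. tauto.
      * replace (p * (1 + Cconj p))%C with (p + p * Cconj p)%C by ring. rewrite Ep. ring.
Qed.

Lemma Re_eq_of_RtoC (w : C) (r : R) : w = RtoC r -> Re w = r.
Proof. intros ->. reflexivity. Qed.

Definition harmonic_self_map (w1 w2 dw1 dw2 : C -> C) : Prop :=
  holomorphic_on_disc w1 dw1 /\ holomorphic_on_disc w2 dw2 /\
  (forall z, in_disc z -> in_disc (harmH w1 w2 z)).

(** Conjugating a term does not change its real part, so [l conj w2] may be traded for the analytic
    [conj l w2]. *)
Lemma rotated_harmonic (w1 w2 dw1 dw2 : C -> C) (l : C) :
  harmonic_self_map w1 w2 dw1 dw2 -> Cmod l = 1 ->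
  let f := fun z => (l * w1 z + Cconj l * w2 z)%C in
  holomorphic_on_disc f (fun z => l * dw1 z + Cconj l * dw2 z)%C /\
  (forall z, Re (f z) = Re (l * harmH w1 w2 z)%C) /\
  (forall z, in_disc z -> Rabs (Re (f z)) < 1).
Proof.
  intros (Hw1 & Hw2 & HH) Hl f.
  assert (E : forall z, Re (f z) = Re (l * harmH w1 w2 z)%C).
  { intros z. unfold f, harmH, Re. simpl. ring. }
  split; [|split; [exact E|]].
  - intros z Hz. apply cderiv_plus; apply cderiv_cmul; auto.
  - intros z Hz. rewrite E. eapply Rle_lt_trans; [apply re_le_Cmod|].
    rewrite Cmod_mult, Hl, Rmult_1_l. apply HH, Hz.
Qed.

(** Choose [l] with [l H(z) = |H(z)|] and follow the radius through [z]. *)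
Lemma harmonic_schwarz (w1 w2 dw1 dw2 : C -> C) (z : C) :
  harmonic_self_map w1 w2 dw1 dw2 -> harmH w1 w2 0%C = RtoC 0 -> in_disc z ->
  Cmod (harmH w1 w2 z) <= 4 / PI * atan (Cmod z).
Proof.
  intros Hm H0 Hz.
  destruct (unimodular_phase (harmH w1 w2 z)) as (l & Hl & El).
  destruct (unimodular_polar z) as (e & He & Ee).
  destruct (rotated_harmonic w1 w2 dw1 dw2 l Hm Hl) as (Hf & ER & Hb).
  rewrite <- (Re_eq_of_RtoC _ _ El), <- ER. rewrite Ee at 1 2.
  apply (strip_growth_radial _ _ e (Cmod z) Hf); trivial.
  - rewrite ER, H0, Cmult_0_r. reflexivity.
  - split; [apply Cmod_ge_0|exact Hz].
Qed.

Lemma rotated_deriv_bound (w1 w2 dw1 dw2 : C -> C) (l z : C) :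
  harmonic_self_map w1 w2 dw1 dw2 -> Cmod l = 1 -> in_disc z ->
  Cmod (l * dw1 z + Cconj l * dw2 z) * (1 - Cmod z ^ 2) <= 4 / PI.
Proof.
  intros Hm Hl Hz. pose proof PI_RGT_0.
  destruct (rotated_harmonic w1 w2 dw1 dw2 l Hm Hl) as (Hf & ER & Hb).
  eapply Rle_trans; [apply (strip_schwarz_pick _ _ z Hf); [|exact Hz]|].
  - intros y Hy. apply Rlt_le, Hb, Hy.
  - rewrite <- (Rmult_1_r (4 / PI)) at 2. apply Rmult_le_compat_l.
    + apply Rdiv_le_0_compat; lra.
    + apply COS_bound.
Qed.

(** A single [l] must align [l w1'] with [conj l w2']. If [e1], [e2] turn [w1'], [w2'] into their
    moduli, [l^2 = e1 conj e2] does so: the sum becomes [l conj e1 (|w1'| + |w2'|)]. *)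
Lemma harmonic_deriv_bound (w1 w2 dw1 dw2 : C -> C) (z : C) :
  harmonic_self_map w1 w2 dw1 dw2 -> in_disc z ->
  (Cmod (dw1 z) + Cmod (dw2 z)) * (1 - Cmod z ^ 2) <= 4 / PI.
Proof.
  intros Hm Hz.
  destruct (unimodular_phase (dw1 z)) as (e1 & H1 & E1).
  destruct (unimodular_phase (dw2 z)) as (e2 & H2 & E2).
  destruct (unimodular_sqrt (e1 * Cconj e2)) as (l & Hl & El).
  { rewrite Cmod_mult, Cmod_conj, H1, H2. ring. }
  replace (Cmod (dw1 z) + Cmod (dw2 z)) with (Cmod (l * dw1 z + Cconj l * dw2 z)).
  { apply (rotated_deriv_bound w1 w2); trivial. }
  assert (C1 := Cmod1_conj e1 H1). assert (C2 := Cmod1_conj e2 H2). assert (Cl := Cmod1_conj l Hl).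
  assert (Ec : Cconj l = (l * Cconj e1 * e2)%C).
  { replace (l * Cconj e1 * e2)%C with (l * Cconj e1 * e2 * (l * Cconj l))%C by (rewrite Cl; ring).
    replace (l * Cconj e1 * e2 * (l * Cconj l))%C
      with (l * l * (Cconj e1 * e2) * Cconj l)%C by ring.
    rewrite El.
    replace (e1 * Cconj e2 * (Cconj e1 * e2) * Cconj l)%C
      with ((e1 * Cconj e1) * (e2 * Cconj e2) * Cconj l)%C by ring.
    rewrite C1, C2. ring. }
  replace (l * dw1 z + Cconj l * dw2 z)%C with (l * Cconj e1 * RtoC (Cmod (dw1 z) + Cmod (dw2 z)))%C.
  - rewrite !Cmod_mult, Cmod_conj, Hl, H1, Cmod_R, Rabs_pos_eq; [ring|].
    apply Rplus_le_le_0_compat; apply Cmod_ge_0.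
  - rewrite RtoC_plus, <- E1, <- E2, Ec.
    replace (l * Cconj e1 * (e1 * dw1 z + e2 * dw2 z))%C
      with (l * (e1 * Cconj e1) * dw1 z + l * Cconj e1 * e2 * dw2 z)%C by ring.
    rewrite C1. ring.
Qed.

(** * The second summand of [u] and the first derivatives of [u] at the origin *)

Lemma biharmonic_correction_bound (w1 w2 dw1 dw2 : C -> C) (z : C) :
  harmonic_self_map w1 w2 dw1 dw2 -> in_disc z ->
  Cmod (RtoC ((1 - Cmod z ^ 2) / 2) * (z * dw1 z + Cconj (z * dw2 z))) <= Cmod z.
Proof.
  intros Hm Hz. assert (Hz0 := Cmod_ge_0 z).
  assert (Hz1 : 0 <= 1 - Cmod z ^ 2) by (unfold in_disc in Hz; nra).
  rewrite Cmod_mult, Cmod_R, Rabs_pos_eq by lra.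
  assert (T : Cmod (z * dw1 z + Cconj (z * dw2 z)) <= Cmod z * (Cmod (dw1 z) + Cmod (dw2 z))).
  { eapply Rle_trans; [apply Cmod_triangle|]. rewrite Cmod_conj, !Cmod_mult. lra. }
  pose proof (harmonic_deriv_bound w1 w2 dw1 dw2 z Hm Hz) as B.
  (* The derivative bound yields [(2 / PI) |z|], which this relaxes to [|z|]. *)
  assert (P4 : 4 / PI <= 2).
  { pose proof PI2_3_2. apply Rmult_le_reg_r with PI; [lra|].
    unfold Rdiv. rewrite Rmult_assoc, Rinv_l; lra. }
  apply (Rmult_le_compat_l (1 - Cmod z ^ 2)) in T; [|lra].
  apply (Rmult_le_compat_l (Cmod z)) in B; [|lra].
  nra.
Qed.

(* The derivative estimate at the centre, applied to [w (c + z/2) - w (z/2)]. *)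
Lemma deriv_lipschitz_at_0 (w dw : C -> C) (M : R) (c : C) :
  holomorphic_on_disc w dw -> 0 < M ->
  (forall z, Cmod z <= 3 / 4 -> Cmod (dw z) <= M) -> Cmod c <= 1 / 4 ->
  Cmod (dw c - dw 0%C) <= 8 / PI * M * Cmod c.
Proof.
  intros Hw HM Hb Hc. pose proof PI_RGT_0 as Hpi. assert (c0 := Cmod_ge_0 c).
  destruct (Req_dec (Cmod c) 0) as [E0|N].
  { rewrite E0, (Cmod_eq_0 _ E0). replace (dw 0 - dw 0)%C with (RtoC 0) by ring.
    rewrite Cmod_0. lra. }
  (* [k] bounds the increment of [w] over a segment of length [|c|], so division by [k] lands in the
     strip. *)
  set (k := M * Cmod c). assert (Hk : 0 < k) by (apply Rmult_lt_0_compat; lra).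
  set (p := fun z : C => (RtoC (/ 2) * z)%C).
  assert (Hp : forall z, Cmod (p z) = Cmod z / 2).
  { intros z. unfold p. rewrite Cmod_mult, Cmod_R, Rabs_pos_eq; lra. }
  assert (dp : forall z, cderiv p z (RtoC (/ 2))).
  { intros z. eapply cderiv_eq; [apply cderiv_cmul, cderiv_id|ring]. }
  assert (dq : forall z, cderiv (fun z => c + p z)%C z (RtoC (/ 2))).
  { intros z. eapply cderiv_eq; [apply cderiv_plus; [apply cderiv_const|apply dp]|ring]. }
  (* The radius is [1 / 2 + 1 / 4]: halving [z] leaves room for the shift by [c]. *)
  assert (Hseg : forall z s, in_disc z -> 0 <= s <= 1 -> Cmod (p z + c * RtoC s) <= 3 / 4).
  { intros z s Hz Hs. unfold in_disc in Hz. eapply Rle_trans; [apply Cmod_triangle|].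
    rewrite Hp, Cmod_mult, Cmod_R, Rabs_pos_eq by lra. nra. }
  pose proof (strip_deriv0 (fun z => RtoC (/ k) * (w (c + p z) + - (1) * w (p z)))%C
    (fun z => RtoC (/ k) * (RtoC (/ 2) * dw (c + p z) + - (1) * (RtoC (/ 2) * dw (p z))))%C) as K.
  cbv beta in K.
  replace (p 0%C) with (RtoC 0) in K by (unfold p; ring).
  replace (c + 0)%C with c in K by ring.
  replace (RtoC (/ k) * (RtoC (/ 2) * dw c + - (1) * (RtoC (/ 2) * dw 0%C)))%C
    with (RtoC (/ (2 * k)) * (dw c - dw 0%C))%C in K.
  2:{ replace (/ (2 * k)) with (/ k * / 2) by (field; lra). rewrite RtoC_mult. ring. }
  rewrite Cmod_mult, Cmod_R, Rabs_pos_eq in K.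
  2:{ apply Rlt_le, Rinv_0_lt_compat; lra. }
  assert (K' : / (2 * k) * Cmod (dw c - dw 0%C) <= 4 / PI).
  { eapply Rle_trans; [apply K|].
    - intros z Hz. apply cderiv_cmul. apply cderiv_plus.
      + apply (cderiv_comp w (fun z => c + p z)%C); [|apply dq]. apply Hw.
        pose proof (Hseg z 1 Hz ltac:(lra)) as B. unfold in_disc.
        replace (c + p z)%C with (p z + c * RtoC 1)%C by ring. lra.
      + apply cderiv_cmul. apply (cderiv_comp w p); [|apply dp]. apply Hw.
        unfold in_disc in *. rewrite Hp. assert (H0 := Cmod_ge_0 z). lra.
    - intros z Hz.
      set (F := fun s => Re (w (p z + c * RtoC s)%C)).
      assert (HF : forall s, 0 <= s <= 1 -> is_derive F s (Re (c * dw (p z + c * RtoC s))%C)).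
      { intros s Hs. pose proof (Hseg z s Hz Hs) as B.
        refine (proj1 (cderiv_directional w (p z) c _ s (Hw _ _))). unfold in_disc. lra. }
      (* Only the real part of the increment has to be bounded, so the real mean value theorem
         applies. *)
      destruct (MVT_gen F 0 1 (fun s => Re (c * dw (p z + c * RtoC s))%C)) as (s & Hs & E).
      { intros s Hs. rewrite Rmin_left, Rmax_right in Hs by lra. apply HF. lra. }
      { intros s Hs. rewrite Rmin_left, Rmax_right in Hs by lra.
        apply continuity_pt_filterlim, (@ex_derive_continuous R_AbsRing R_NormedModule).
        eexists. apply HF. lra. }
      rewrite Rmin_left, Rmax_right in Hs by lra.
      replace (Re (RtoC (/ k) * (w (c + p z) + - (1) * w (p z)))%C) with (/ k * (F 1 - F 0)).
      2:{ unfold F. replace (p z + c * RtoC 1)%C with (c + p z)%C by ring.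
          replace (p z + c * RtoC 0)%C with (p z) by ring.
          unfold Re; simpl. ring. }
      rewrite E, Rabs_mult, Rabs_pos_eq by (apply Rlt_le, Rinv_0_lt_compat; lra).
      apply Rmult_le_reg_l with k; [lra|].
      rewrite <- Rmult_assoc, Rinv_r, Rmult_1_l, Rmult_1_r, Rminus_0_r, Rmult_1_r by lra.
      eapply Rle_trans; [apply re_le_Cmod|]. rewrite Cmod_mult. unfold k.
      rewrite Rmult_comm. apply Rmult_le_compat_r; [lra|]. apply Hb, Hseg; [exact Hz|exact Hs].
    - rewrite <- (Rmult_1_r (4 / PI)) at 2. apply Rmult_le_compat_l.
      + apply Rdiv_le_0_compat; lra.
      + apply COS_bound. }
  apply (Rmult_le_compat_l (2 * k)) in K'; [|lra].
  rewrite <- Rmult_assoc, Rinv_r, Rmult_1_l in K' by lra.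
  eapply Rle_trans; [exact K'|]. right. unfold k. field. lra.
Qed.

(** The difference quotient at 0 is [(1 - h^2) / 2 * k h], so the derivative comes from continuity
    of [k] at 0, without differentiating [k]. *)
Lemma is_derive_weighted_at_0 (k : R -> R) (L : R) :
  (forall t, Rabs t <= 1 / 4 -> Rabs (k t - k 0) <= L * Rabs t) ->
  is_derive (fun t => (1 - t ^ 2) / 2 * (t * k t)) 0 (k 0 / 2).
Proof.
  intros Hk.
  assert (Hc : continuity_pt k 0).
  { intros eps He. exists (Rmin (1 / 4) (eps / (Rabs L + 1))).
    assert (L0 := Rabs_pos L). assert (L1 := Rle_abs L).
    split; [apply Rmin_pos; [lra|apply Rdiv_lt_0_compat; lra]|].
    intros t [_ Ht]. simpl in *. unfold R_dist in *. rewrite Rminus_0_r in Ht.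
    assert (H1 := Rlt_le_trans _ _ _ Ht (Rmin_l _ _)).
    assert (H2 := Rlt_le_trans _ _ _ Ht (Rmin_r _ _)).
    eapply Rle_lt_trans; [apply Hk; lra|]. assert (t0 := Rabs_pos t).
    apply (Rmult_lt_compat_r (Rabs L + 1)) in H2; [|lra].
    unfold Rdiv in H2. rewrite Rmult_assoc, Rinv_l, Rmult_1_r in H2 by lra. nra. }
  set (K := fun t => (1 - t ^ 2) / 2 * k t).
  assert (HK : continuity_pt K 0).
  { apply continuity_pt_mult; [reg|exact Hc]. }
  apply is_derive_Reals. intros eps He.
  destruct (HK eps He) as (al & al0 & Hal). exists (mkposreal al al0). simpl.
  intros h Nh Hh. rewrite Rplus_0_l.
  replace (((1 - h * (h * 1)) / 2 * (h * k h) - (1 - 0 * (0 * 1)) / 2 * (0 * k 0)) / h - k 0 / 2)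
    with (K h - K 0) by (unfold K; field; exact Nh).
  apply Hal. split.
  - split; [exact I|]. auto.
  - simpl. unfold R_dist. rewrite Rminus_0_r. exact Hh.
Qed.

(** [D] is the derivative of [H] at 0 in the direction [d]. Along [t d] the second summand of [u] is
    [(1 - t^2) / 2 * t * q t] with [q 0 = D], which adds [D / 2]. *)
Lemma biharm_directional_deriv (w1 w2 dw1 dw2 : C -> C) (d : C) (L : R) :
  holomorphic_on_disc w1 dw1 -> holomorphic_on_disc w2 dw2 -> Cmod d = 1 ->
  (forall c, Cmod c <= 1 / 4 -> Cmod (dw1 c - dw1 0%C) <= L * Cmod c) ->
  (forall c, Cmod c <= 1 / 4 -> Cmod (dw2 c - dw2 0%C) <= L * Cmod c) ->
  let u := biharm_u w1 w2 dw1 dw2 in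
  let D := (d * dw1 0%C + Cconj (d * dw2 0%C))%C in
  Derive (fun t => Re (u (RtoC 0 + d * RtoC t)%C)) 0 = 3 / 2 * Re D /\
  Derive (fun t => Im (u (RtoC 0 + d * RtoC t)%C)) 0 = 3 / 2 * Im D.
Proof.
  intros H1 H2 Hd L1 L2 u D.
  assert (D0 : in_disc (RtoC 0 + d * RtoC 0)%C).
  { replace (RtoC 0 + d * RtoC 0)%C with (RtoC 0) by ring. unfold in_disc. rewrite Cmod_0. lra. }
  assert (E0 : (RtoC 0 + d * RtoC 0)%C = RtoC 0) by ring.
  assert (Hm : forall t : R, Cmod (RtoC 0 + d * RtoC t) = Rabs t).
  { intros t. rewrite Cplus_0_l, Cmod_mult, Hd, Cmod_R. ring. }
  set (q := fun t : R => (d * dw1 (RtoC 0 + d * RtoC t) + Cconj (d * dw2 (RtoC 0 + d * RtoC t)))%C).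
  assert (Eq0 : q 0 = D) by (unfold q, D; now rewrite E0).
  assert (Hq : forall t, Rabs t <= 1 / 4 -> Cmod (q t - q 0) <= 2 * L * Rabs t).
  { intros t Ht. rewrite Eq0. unfold q, D.
    rewrite <- (Hm t) in Ht. specialize (L1 _ Ht). specialize (L2 _ Ht). rewrite Hm in L1, L2.
    set (z := (RtoC 0 + d * RtoC t)%C) in *.
    replace (d * dw1 z + Cconj (d * dw2 z) - (d * dw1 0%C + Cconj (d * dw2 0%C)))%C
      with (d * (dw1 z - dw1 0%C) + Cconj (d * (dw2 z - dw2 0%C)))%C.
    - eapply Rle_trans; [apply Cmod_triangle|]. rewrite Cmod_conj, !Cmod_mult, Hd. lra.
    - apply injective_projections; simpl; ring. }
  assert (Eu : forall t : R, u (RtoC 0 + d * RtoC t)%C =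
    (w1 (RtoC 0 + d * RtoC t) + Cconj (w2 (RtoC 0 + d * RtoC t))
     + RtoC ((1 - t ^ 2) / 2) * (RtoC t * q t))%C).
  { intros t. unfold u, biharm_u, harmH. rewrite Hm, pow2_abs. unfold q. f_equal. f_equal.
    rewrite !Cplus_0_l. set (a := dw1 _). set (b := dw2 _).
    apply injective_projections; simpl; ring. }
  destruct (cderiv_directional w1 _ d _ 0 (H1 _ D0)) as [R1 I1].
  destruct (cderiv_directional w2 _ d _ 0 (H2 _ D0)) as [R2 I2].
  rewrite E0 in R1, I1, R2, I2.
  split; apply is_derive_unique.
  - assert (R3 : is_derive (fun t => (1 - t ^ 2) / 2 * (t * Re (q t))) 0 (Re (q 0) / 2)).
    { apply (is_derive_weighted_at_0 (fun t => Re (q t)) (2 * L)). intros t Ht.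
      eapply Rle_trans; [|apply (Hq t Ht)]. eapply Rle_trans; [|apply re_le_Cmod].
      right; f_equal; unfold Re; simpl; ring. }
    rewrite Eq0 in R3.
    pose proof (is_derive_plus _ _ _ _ _ (is_derive_plus _ _ _ _ _ R1 R2) R3) as K.
    replace (3 / 2 * Re D) with (plus (plus (Re (d * dw1 0%C)) (Re (d * dw2 0%C))) (Re D / 2)).
    + apply is_derive_ext with (2 := K). intros t. rewrite Eu. unfold plus, Re; simpl. ring.
    + unfold plus, D, Re; simpl. field.
  - assert (I3 : is_derive (fun t => (1 - t ^ 2) / 2 * (t * Im (q t))) 0 (Im (q 0) / 2)).
    { apply (is_derive_weighted_at_0 (fun t => Im (q t)) (2 * L)). intros t Ht.
      eapply Rle_trans; [|apply (Hq t Ht)].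
      eapply Rle_trans; [|eapply Rle_trans; [apply Rmax_r|apply Rmax_Cmod]].
      right; f_equal; unfold Im; simpl; ring. }
    rewrite Eq0 in I3.
    (* The difference reflects the conjugate on [w2]. *)
    pose proof (is_derive_plus _ _ _ _ _ (is_derive_minus _ _ _ _ _ I1 I2) I3) as K.
    replace (3 / 2 * Im D) with (plus (minus (Im (d * dw1 0%C)) (Im (d * dw2 0%C))) (Im D / 2)).
    + apply is_derive_ext with (2 := K). intros t. rewrite Eu.
      unfold minus, plus, opp, Im; simpl. ring.
    + unfold minus, plus, opp, D, Im; simpl. field.
Qed.

Theorem theorem3 (w1 w2 dw1 dw2 : Complex.C -> Complex.C) :
  analytic_on_disc_with w1 dw1 ->
  analytic_on_disc_with w2 dw2 ->
  (forall z, in_disc z -> in_disc (harmH w1 w2 z)) ->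
  (forall z, in_disc z -> in_disc (biharm_u w1 w2 dw1 dw2 z)) ->
  biharm_u w1 w2 dw1 dw2 (RtoC 0) = RtoC 0 ->
  (forall z, in_disc z ->
     Cmod (biharm_u w1 w2 dw1 dw2 z) <= 4 / PI * atan (Cmod z) + Cmod z)
  /\ Lambda (biharm_u w1 w2 dw1 dw2) (RtoC 0) <= 6 / PI.
Proof.
  intros A1 A2 HH _ Hu0. pose proof PI_RGT_0 as Hpi.
  assert (H1 : holomorphic_on_disc w1 dw1) by (intros z Hz; apply is_derive_cderiv, A1, Hz).
  assert (H2 : holomorphic_on_disc w2 dw2) by (intros z Hz; apply is_derive_cderiv, A2, Hz).
  assert (HH0 : harmH w1 w2 (RtoC 0) = RtoC 0).
  { etransitivity; [|exact Hu0]. unfold biharm_u. apply injective_projections; simpl; ring. }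
  assert (Hm : harmonic_self_map w1 w2 dw1 dw2) by (split; [|split]; trivial).
  pose proof (fun z => harmonic_deriv_bound w1 w2 dw1 dw2 z Hm) as HB.
  split.
  - intros z Hz. unfold biharm_u. eapply Rle_trans; [apply Cmod_triangle|].
    apply Rplus_le_compat.
    + apply (harmonic_schwarz w1 w2 dw1 dw2); trivial.
    + apply (biharmonic_correction_bound w1 w2 dw1 dw2); trivial.
  (* On [|z| <= 3 / 4] one has [1 - |z|^2 >= 7 / 16], so [M] bounds [|w1'| + |w2'|] there. *)
  - set (M := 4 / PI * (16 / 7)).
    assert (P4 : 0 < 4 / PI) by (apply Rdiv_lt_0_compat; lra).
    assert (HM : 0 < M) by (unfold M; lra).
    assert (Hsum : forall z, Cmod z <= 3 / 4 -> Cmod (dw1 z) + Cmod (dw2 z) <= M).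
    { intros z Hz. assert (Z0 := Cmod_ge_0 z). specialize (HB z ltac:(unfold in_disc; lra)).
      assert (S1 := Cmod_ge_0 (dw1 z)). assert (S2 := Cmod_ge_0 (dw2 z)).
      assert (7 / 16 <= 1 - Cmod z ^ 2) by nra. unfold M. nra. }
    assert (L1 : forall c, Cmod c <= 1 / 4 -> Cmod (dw1 c - dw1 0%C) <= 8 / PI * M * Cmod c).
    { intros c Hc. apply (deriv_lipschitz_at_0 w1); trivial.
      intros z Hz. specialize (Hsum z Hz). assert (S2 := Cmod_ge_0 (dw2 z)). lra. }
    assert (L2 : forall c, Cmod c <= 1 / 4 -> Cmod (dw2 c - dw2 0%C) <= 8 / PI * M * Cmod c).
    { intros c Hc. apply (deriv_lipschitz_at_0 w2); trivial.
      intros z Hz. specialize (Hsum z Hz). assert (S1 := Cmod_ge_0 (dw1 z)). lra. }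
    set (u := biharm_u w1 w2 dw1 dw2).
    destruct (biharm_directional_deriv w1 w2 dw1 dw2 1%C _ H1 H2 Cmod_1 L1 L2) as [X1 X2].
    destruct (biharm_directional_deriv w1 w2 dw1 dw2 Ci _ H1 H2 Cmod_Ci L1 L2) as [Y1 Y2].
    fold u in X1, X2, Y1, Y2.
    assert (EX : dx u (RtoC 0) = (RtoC (3 / 2) * (dw1 0%C + Cconj (dw2 0%C)))%C).
    { unfold dx. rewrite (Derive_ext _ (fun t => Re (u (RtoC 0 + 1 * RtoC t)%C))), X1
        by (intros t; now rewrite Cmult_1_l).
      rewrite (Derive_ext _ (fun t => Im (u (RtoC 0 + 1 * RtoC t)%C))), X2
        by (intros t; now rewrite Cmult_1_l).
      apply injective_projections; unfold Re, Im; simpl; ring. }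
    assert (EY : dy u (RtoC 0) = (RtoC (3 / 2) * (Ci * dw1 0%C + Cconj (Ci * dw2 0%C)))%C).
    { unfold dy. rewrite Y1, Y2. apply injective_projections; unfold Re, Im; simpl; ring. }
    (* The Wirtinger combinations of the directions [1] and [Ci] separate the analytic part from the
       conjugate one. *)
    assert (EZ : dz u (RtoC 0) = (RtoC (3 / 2) * dw1 0%C)%C).
    { unfold dz. rewrite EX, EY. apply injective_projections; simpl; field. }
    assert (EZb : dzbar u (RtoC 0) = (RtoC (3 / 2) * Cconj (dw2 0%C))%C).
    { unfold dzbar. rewrite EX, EY. apply injective_projections; simpl; field. }
    unfold Lambda. rewrite EZ, EZb, !Cmod_mult, Cmod_conj, Cmod_R, Rabs_pos_eq by lra.
    specialize (HB (RtoC 0)). unfold in_disc in HB. rewrite Cmod_0 in HB. specialize (HB ltac:(lra)).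
    replace (6 / PI) with (3 / 2 * (4 / PI)) by (field; lra). lra.
Qed.
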